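(* Let $\mathcal R\subseteq\{\mathsf c,\mathsf w\}$. Every strongly normalising $\lambda_{\mathcal R}$-term $M$ is typeable in the system $\lambda_{\mathcal R}\cap$, i.e. there are a basis $\Gamma$ and a strict type $\sigma$ with $\Gamma\vdash_{\mathcal R}M:\sigma$.
   Context: **Conventions.** $\mathcal R\subseteq\{\mathsf c,\mathsf w\}$ is fixed; a condition in brackets $[\cdot]_{\mathsf r}$ is imposed only if $\mathsf r\in\mathcal R$. Everything is up to $\alpha$-conversion with Barendregt's convention (no variable both free and bound). $\lambda x.M$ binds $x$; $x<^{x_1}_{x_2}M$ (contraction) binds $x_1,x_2$; in $x\odot M$ (weakening) $x$ is free. For a finite set of variables $X=\{x_1,\dots,x_n\}$, $X\odot M$ means $x_1\odot\cdots x_n\odot M$ (and $M$ if $X=\emptyset$). For lists $X,Y,Z$ of $n$ distinct variables, $X<^Y_Z M$ means $x_1<^{y_1}_{z_1}\cdots x_n<^{y_n}_{z_n}M$. **Terms.** Pre-terms: $f::=x\mid\lambda x.f\mid ff\mid x<^{x_1}_{x_2}f\mid x\odot f$. $Fv(x)=\{x\}$, $Fv(\lambda x.f)=Fv(f)\setminus\{x\}$, $Fv(fg)=Fv(f)\cup Fv(g)$, $Fv(x\odot f)=\{x\}\cup Fv(f)$, $Fv(x<^{x_1}_{x_2}f)=Fv(f)$ if $x_1,x_2\notin Fv(f)$ and $\{x\}\cup(Fv(f)\setminus\{x_1,x_2\})$ otherwise. The set $\Lambda_{\mathcal R}$ of $\lambda_{\mathcal R}$-terms is the least set such that: $x\in\Lambda_{\mathcal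 R}$; $\lambda x.f\in\Lambda_{\mathcal R}$ if $f\in\Lambda_{\mathcal R}$ and $[x\in Fv(f)]_{\mathsf w}$; $fg\in\Lambda_{\mathcal R}$ if $f,g\in\Lambda_{\mathcal R}$ and $[Fv(f)\cap Fv(g)=\emptyset]_{\mathsf c}$; if $\mathsf w\in\mathcal R$: $x\odot f\in\Lambda_{\mathcal R}$ if $f\in\Lambda_{\mathcal R}$, $x\notin Fv(f)$; if $\mathsf c\in\mathcal R$: $x<^{x_1}_{x_2}f\in\Lambda_{\mathcal R}$ if $f\in\Lambda_{\mathcal R}$, $x_1\ne x_2$, $x\notin Fv(f)\setminus\{x_1,x_2\}$, $[x_1,x_2\in Fv(f)]_{\mathsf w}$. **Substitution** $M[N/x]$ (with $x$ not bound in $M$, $[Fv(M)\cap Fv(N)=\emptyset]_{\mathsf c}$, $[x\in Fv(M)]_{\mathsf w}$): $x[N/x]=N$; $y[N/x]=y$ ($y\neq x$); $(\lambda y.M)[N/x]=\lambda y.M[N/x]$; $(MP)[N/x]=M[N/x]\,P[N/x]$; $(y\odot M)[N/x]=(\{y\}\setminus Fv(N))\odot M[N/x]$ ($y\ne x$); $(x\odot M)[N/x]=(Fv(N)\setminus Fv(M))\odot M$; $(y<^{y_1}_{y_2}M)[N/x]=y<^{y_1}_{y_2}M[N/x]$ ($y\neq x$); $(x<^{x_1}_{x_2}M)[N/x]=Fv(N)<^{Fv(N_1)}_{Fv(N_2)}M[N_1/x_1,N_2/x_2]$ (parallel substitution), where $N_1,N_2$ are copies of $N$ with all free variables renamed to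 fresh ones. **Reduction** (closed under all term constructors): $(\beta)$ $(\lambda x.M)N\to M[N/x]$; $(\gamma_0)$ $x<^{x_1}_{x_2}y\to y$ ($y\ne x_1,x_2$); $(\gamma_0')$ $x<^{x_1}_{x_2}x_1\to x$; $(\gamma_1)$ $x<^{x_1}_{x_2}(\lambda y.M)\to\lambda y.x<^{x_1}_{x_2}M$; $(\gamma_2)$ $x<^{x_1}_{x_2}(MN)\to(x<^{x_1}_{x_2}M)N$ if $x_1,x_2\notin Fv(N)$; $(\gamma_3)$ $x<^{x_1}_{x_2}(MN)\to M(x<^{x_1}_{x_2}N)$ if $x_1,x_2\notin Fv(M)$; $(\omega_1)$ $\lambda x.(y\odot M)\to y\odot(\lambda x.M)$, $x\ne y$; $(\omega_2)$ $(x\odot M)N\to(\{x\}\setminus Fv(N))\odot(MN)$; $(\omega_3)$ $M(x\odot N)\to(\{x\}\setminus Fv(M))\odot(MN)$; $(\gamma\omega_1)$ $x<^{x_1}_{x_2}(y\odot M)\to y\odot(x<^{x_1}_{x_2}M)$, $y\ne x_1,x_2$; $(\gamma\omega_2)$ $x<^{x_1}_{x_2}(x_1\odot M)\to M[x/x_2]$. Equivalences (generating a congruence $\equiv$): $(\epsilon_1)$ $x\odot(y\odot M)\equiv y\odot(x\odot M)$; $(\epsilon_2)$ $x<^{x_1}_{x_2}M\equiv x<^{x_2}_{x_1}M$; $(\epsilon_3)$ $x<^y_z(y<^u_vM)\equiv x<^y_u(y<^z_vM)$; $(\epsilon_4)$ $x<^{x_1}_{x_2}(y<^{y_1}_{y_2}M)\equiv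 y<^{y_1}_{y_2}(x<^{x_1}_{x_2}M)$ if $x\neq y_1,y_2$, $y\ne x_1,x_2$. Active rules: $\mathcal R=\emptyset$: $\beta$. $\mathcal R=\{\mathsf c\}$: $\beta,\gamma_0,\gamma_0',\gamma_1,\gamma_2,\gamma_3$ and $\epsilon_2,\epsilon_3,\epsilon_4$. $\mathcal R=\{\mathsf w\}$: $\beta,\omega_1,\omega_2,\omega_3$ and $\epsilon_1$. $\mathcal R=\{\mathsf c,\mathsf w\}$: $\beta,\gamma_1,\gamma_2,\gamma_3,\omega_1,\omega_2,\omega_3,\gamma\omega_1,\gamma\omega_2$ and $\epsilon_1$–$\epsilon_4$. A term is strongly normalising if there is no infinite sequence starting from it in which each step is $\to$ or $\equiv$ and infinitely many steps are $\to$. **Types.** Strict types $\sigma::=p\mid\alpha\to\sigma$; types $\alpha::=\sigma_1\cap\dots\cap\sigma_n=:\cap_i^n\sigma_i$ ($n\ge1$), $p$ a type atom, $\cap$ idempotent, commutative, associative. A basis is a finite set of declarations $x:\alpha$ with distinct variables; $\Gamma,x:\alpha$ presupposes $x\notin Dom(\Gamma)$. $\Gamma\sqcup\Delta$ is the union of bases in which a variable declared $\alpha$ in $\Gamma$ and $\beta$ in $\Delta$ gets $\alpha\cap\beta$. $\Gamma\sqcup_{\mathsf c}\Delta$ is $\Gamma\sqcup\Delta$ if $\mathsf c\notin\mathcal R$, and the disjoint union $\Gamma,\Delta$ if $\mathsf c\in\mathcal R$. System $\lambda_{\mathcal R}\cap$: $(Ax_{iw})$ if $\mathsf w\notin\mathcal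 R$: $\Gamma,x:\cap_i^n\sigma_i\vdash_{\mathcal R}x:\sigma_i$; $(Ax_{ew})$ if $\mathsf w\in\mathcal R$: $x:\cap_i^n\sigma_i\vdash_{\mathcal R}x:\sigma_i$; $(\to_I)$ from $\Gamma,x:\alpha\vdash_{\mathcal R}M:\sigma$ infer $\Gamma\vdash_{\mathcal R}\lambda x.M:\alpha\to\sigma$; $(\to_E)$ from $\Gamma\vdash_{\mathcal R}M:\cap_i^n\tau_i\to\sigma$ and $\Delta_i\vdash_{\mathcal R}N:\tau_i$ ($i=1..n$, $Dom(\Delta_1)=\dots=Dom(\Delta_n)$) infer $\Gamma\sqcup_{\mathsf c}(\Delta_1\sqcup\dots\sqcup\Delta_n)\vdash_{\mathcal R}MN:\sigma$; $(Cont)$ if $\mathsf c\in\mathcal R$: from $\Gamma,x:\alpha,y:\beta\vdash_{\mathcal R}M:\sigma$ infer $\Gamma,z:\alpha\cap\beta\vdash_{\mathcal R}z<^x_yM:\sigma$; $(Weak)$ if $\mathsf w\in\mathcal R$: from $\Gamma\vdash_{\mathcal R}M:\sigma$ infer $\Gamma,x:\alpha\vdash_{\mathcal R}x\odot M:\sigma$.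
   Formalization: For R={c}, the name x of a contraction x<^{x1}_{x2}M with x1,x2 not free in M may be renamed by α-conversion, in reduction and in typing; otherwise (x<^{x1}_{x2}y)x is a strongly normalising term that is not typeable. *)

(* Defs.v *)
From mathcomp Require Import all_boot.
From mathcomp Require Import finmap.
From Stdlib Require Import Relation_Operators.

Set Implicit Arguments.
Unset Strict Implicit.
Unset Printing Implicit Defensive.

Local Open Scope fset_scope.
Local Open Scope fmap_scope.

(* A subset of {c, w} is a [pred resource]; a condition in brackets [.]_r is
   an implication [R r -> .]. *)
Inductive resource := rc | rw.

(* Term variables are natural numbers.
   [Con x x1 x2 f] is the contraction x <^{x1}_{x2} f, which binds x1 and x2 in
   f; [Wk x f] is the weakening x (.) f. *)
Inductive pterm :=
| Var (x : nat)
| Lam (x : nat) (f : pterm)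
| App (f g : pterm)
| Con (x x1 x2 : nat) (f : pterm)
| Wk (x : nat) (f : pterm).

Fixpoint fv (f : pterm) : {fset nat} :=
  match f with
  | Var x => [fset x]
  | Lam x g => fv g `\ x
  | App g h => fv g `|` fv h
  | Con x x1 x2 g =>
      if (x1 \notin fv g) && (x2 \notin fv g) then fv g
      else x |` (fv g `\` [fset x1; x2])
  | Wk x g => x |` fv g
  end.

Inductive lterm (R : pred resource) : pterm -> Prop :=
| lt_var x : lterm R (Var x)
| lt_lam (x : nat) f :
    lterm R f -> (R rw -> x \in fv f) -> lterm R (Lam x f)
| lt_app f g :
    lterm R f -> lterm R g -> (R rc -> [disjoint fv f & fv g]) ->
    lterm R (App f g)
| lt_wk (x : nat) f :
    R rw -> lterm R f -> x \notin fv f -> lterm R (Wk x f)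
| lt_con (x x1 x2 : nat) f :
    R rc -> lterm R f -> x1 != x2 -> x \notin fv f `\` [fset x1; x2] ->
    (R rw -> (x1 \in fv f) && (x2 \in fv f)) ->
    lterm R (Con x x1 x2 f).

(* All names occurring in a pre-term, binders included. *)
Fixpoint names (f : pterm) : {fset nat} :=
  match f with
  | Var x => [fset x]
  | Lam x g => x |` names g
  | App g h => names g `|` names h
  | Con x x1 x2 g => [fset x; x1; x2] `|` names g
  | Wk x g => x |` names g
  end.

(* [ren r f] applies r to every name of f, binders included.  It is used only
   with r injective on [names f]; up to alpha-conversion it then renames the
   free variables of f by r. *)
Fixpoint ren (r : nat -> nat) (f : pterm) : pterm :=
  match f with
  | Var x => Var (r x)
  | Lam x g => Lam (r x) (ren r g)
  | App g h => App (ren r g) (ren r h)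
  | Con x x1 x2 g => Con (r x) (r x1) (r x2) (ren r g)
  | Wk x g => Wk (r x) (ren r g)
  end.

Definition swap (a b : nat) : pterm -> pterm :=
  ren (fun x => if x == a then b else if x == b then a else x).

Inductive compat (r : pterm -> pterm -> Prop) : pterm -> pterm -> Prop :=
| cp_base f g : r f g -> compat r f g
| cp_lam x f g : compat r f g -> compat r (Lam x f) (Lam x g)
| cp_appl f g h : compat r f g -> compat r (App f h) (App g h)
| cp_appr f g h : compat r f g -> compat r (App h f) (App h g)
| cp_con x x1 x2 f g :
    compat r f g -> compat r (Con x x1 x2 f) (Con x x1 x2 g)
| cp_wk x f g : compat r f g -> compat r (Wk x f) (Wk x g).

(* Alpha-conversion renames the variables that are not free.  When x1 and x2
   are not free in M, the variable x is not free in x <^{x1}_{x2} M (see [fv])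
   either, so it is an idle name and is renamed too ([alpha_idle]).  This occurs
   in lambda_R-terms only for R = {c}, and is needed there: otherwise
   (x <^{x1}_{x2} y) x would be a term with no typing, and
   (\z. x <^{x1}_{x2} z) x would reduce to x <^{x1}_{x2} x, not a term. *)
Inductive alpha0 : pterm -> pterm -> Prop :=
| alpha_lam (x y : nat) M :
    y \notin names M -> alpha0 (Lam x M) (Lam y (swap x y M))
| alpha_con1 (x x1 x2 y : nat) M :
    x1 != x2 -> y \notin names M -> y != x2 ->
    alpha0 (Con x x1 x2 M) (Con x y x2 (swap x1 y M))
| alpha_con2 (x x1 x2 y : nat) M :
    x1 != x2 -> y \notin names M -> y != x1 ->
    alpha0 (Con x x1 x2 M) (Con x x1 y (swap x2 y M))
| alpha_idle (x y x1 x2 : nat) M :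
    x1 \notin fv M -> x2 \notin fv M -> x \notin fv M -> y \notin fv M ->
    alpha0 (Con x x1 x2 M) (Con y x1 x2 M).

Definition alpha : pterm -> pterm -> Prop :=
  clos_refl_sym_trans pterm (compat alpha0).

(* X (.) M and X <^Y_Z M; the enumeration order is immaterial up to the
   equivalences epsilon_1 and epsilon_4. *)
Definition mwk (X : seq nat) (M : pterm) : pterm := foldr Wk M X.

Fixpoint mcon (X Y Z : seq nat) (M : pterm) : pterm :=
  match X, Y, Z with
  | x :: X', y :: Y', z :: Z' => Con x y z (mcon X' Y' Z' M)
  | _, _, _ => M
  end.

(* [r] renames the variables of X to distinct names outside A. *)
Definition fresh_ren (X A : {fset nat}) (r : nat -> nat) : Prop :=
  [/\ {in X &, injective r},
      forall y, y \in X -> r y \notin A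
    & forall y, y \notin X -> r y = y].

(* [subst M N x P]: P is M[N/x].  A relation, as the names of the copies of N
   are chosen up to alpha-conversion.  The conditions on bound variables express
   that x is not bound in M and the variable convention; for y <^{y1}_{y2} M the
   condition [y \notin fv N] only adds something when y is idle, since otherwise
   it follows from the disjointness of the free variables of both terms.  In
   the last clause the free variables of N1 are fresh, so the parallel
   substitution is the composite of two single ones. *)
Inductive subst : pterm -> pterm -> nat -> pterm -> Prop :=
| sb_var x N : subst (Var x) N x N
| sb_var_neq (x y : nat) N : y != x -> subst (Var y) N x (Var y)
| sb_lam (x y : nat) M N P :
    y != x -> y \notin fv N -> subst M N x P ->
    subst (Lam y M) N x (Lam y P)
| sb_app x M1 M2 N P1 P2 :
    subst M1 N x P1 -> subst M2 N x P2 ->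
    subst (App M1 M2) N x (App P1 P2)
| sb_wk_neq (x y : nat) M N P :
    y != x -> subst M N x P ->
    subst (Wk y M) N x (mwk ([fset y] `\` fv N) P)
| sb_wk x M N : subst (Wk x M) N x (mwk (fv N `\` fv M) M)
| sb_con_neq (x y y1 y2 : nat) M N P :
    y != x -> y1 != x -> y2 != x ->
    y \notin fv N -> y1 \notin fv N -> y2 \notin fv N ->
    subst M N x P ->
    subst (Con y y1 y2 M) N x (Con y y1 y2 P)
| sb_con (x x1 x2 : nat) M N r1 r2 P1 P2 :
    x1 != x -> x2 != x ->
    fresh_ren (fv N) ([fset x; x1; x2] `|` names M `|` names N) r1 ->
    fresh_ren (fv N) ([fset x; x1; x2] `|` names M `|` names N) r2 ->
    (forall y z, y \in fv N -> z \in fv N -> r1 y != r2 z) ->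
    subst M (ren r1 N) x1 P1 -> subst P1 (ren r2 N) x2 P2 ->
    subst (Con x x1 x2 M) N x
      (mcon (fv N) [seq r1 y | y <- fv N] [seq r2 y | y <- fv N] P2).

Definition subst_ok (R : pred resource) (M N : pterm) (x : nat) : Prop :=
  (R rc -> [disjoint fv M & fv N]) /\ (R rw -> x \in fv M).

(* Where a rule moves a binder over a name, the variable convention is made
   explicit as a side condition. *)
Inductive red0 (R : pred resource) : pterm -> pterm -> Prop :=
| r_beta x M N P :
    subst_ok R M N x -> subst M N x P -> red0 R (App (Lam x M) N) P
| r_gamma0 (x x1 x2 y : nat) :
    R rc -> ~~ R rw -> y != x1 -> y != x2 ->
    red0 R (Con x x1 x2 (Var y)) (Var y)
| r_gamma0' x x1 x2 :
    R rc -> ~~ R rw -> red0 R (Con x x1 x2 (Var x1)) (Var x)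
| r_gamma1 (x x1 x2 y : nat) M :
    R rc -> y \notin [:: x; x1; x2] ->
    red0 R (Con x x1 x2 (Lam y M)) (Lam y (Con x x1 x2 M))
| r_gamma2 (x x1 x2 : nat) M N :
    R rc -> x1 \notin fv N -> x2 \notin fv N ->
    red0 R (Con x x1 x2 (App M N)) (App (Con x x1 x2 M) N)
| r_gamma3 (x x1 x2 : nat) M N :
    R rc -> x1 \notin fv M -> x2 \notin fv M ->
    red0 R (Con x x1 x2 (App M N)) (App M (Con x x1 x2 N))
| r_omega1 (x y : nat) M :
    R rw -> x != y -> red0 R (Lam x (Wk y M)) (Wk y (Lam x M))
| r_omega2 x M N :
    R rw -> red0 R (App (Wk x M) N) (mwk ([fset x] `\` fv N) (App M N))
| r_omega3 x M N :
    R rw -> red0 R (App M (Wk x N)) (mwk ([fset x] `\` fv M) (App M N))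
| r_gammaomega1 (x x1 x2 y : nat) M :
    R rc -> R rw -> y != x1 -> y != x2 ->
    red0 R (Con x x1 x2 (Wk y M)) (Wk y (Con x x1 x2 M))
| r_gammaomega2 x x1 x2 M P :
    R rc -> R rw -> subst_ok R M (Var x) x2 -> subst M (Var x) x2 P ->
    red0 R (Con x x1 x2 (Wk x1 M)) P.

Definition red (R : pred resource) : pterm -> pterm -> Prop := compat (red0 R).

Inductive eps0 (R : pred resource) : pterm -> pterm -> Prop :=
| e_1 x y M : R rw -> eps0 R (Wk x (Wk y M)) (Wk y (Wk x M))
| e_2 x x1 x2 M : R rc -> eps0 R (Con x x1 x2 M) (Con x x2 x1 M)
| e_3 (x y z u v : nat) M :
    R rc -> uniq [:: x; y; z; u; v] ->
    eps0 R (Con x y z (Con y u v M)) (Con x y u (Con y z v M))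
| e_4 (x x1 x2 y y1 y2 : nat) M :
    R rc -> uniq [:: x; x1; x2; y; y1; y2] ->
    eps0 R (Con x x1 x2 (Con y y1 y2 M)) (Con y y1 y2 (Con x x1 x2 M)).

(* Terms are taken up to alpha-conversion, which is thus part of the
   equivalence on their representatives. *)
Definition eqv (R : pred resource) : pterm -> pterm -> Prop :=
  clos_refl_sym_trans pterm (compat (fun M N => alpha0 M N \/ eps0 R M N)).

Definition strongly_normalising (R : pred resource) (M : pterm) : Prop :=
  ~ exists s : nat -> pterm,
      [/\ s 0 = M,
          forall n, lterm R (s n),
          forall n, red R (s n) (s n.+1) \/ eqv R (s n) (s n.+1)
        & forall n, exists2 m, n <= m & red R (s m) (s m.+1)].

Inductive sty :=
| Atom (p : nat)
| Arr (a : ty) (t : sty)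
with ty :=
| Str (t : sty)
| Cap (a b : ty).

(* Equality of types: intersection is idempotent, commutative and
   associative. *)
Inductive sty_eq : sty -> sty -> Prop :=
| se_refl s : sty_eq s s
| se_sym s t : sty_eq s t -> sty_eq t s
| se_trans s t u : sty_eq s t -> sty_eq t u -> sty_eq s u
| se_arr a b s t : ty_eq a b -> sty_eq s t -> sty_eq (Arr a s) (Arr b t)
with ty_eq : ty -> ty -> Prop :=
| te_refl a : ty_eq a a
| te_sym a b : ty_eq a b -> ty_eq b a
| te_trans a b c : ty_eq a b -> ty_eq b c -> ty_eq a c
| te_str s t : sty_eq s t -> ty_eq (Str s) (Str t)
| te_cap a a' b b' : ty_eq a a' -> ty_eq b b' -> ty_eq (Cap a b) (Cap a' b')
| te_idem a : ty_eq (Cap a a) a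
| te_comm a b : ty_eq (Cap a b) (Cap b a)
| te_assoc a b c : ty_eq (Cap a (Cap b c)) (Cap (Cap a b) c).

(* F 0 op (F 1 op ( ... op F n)): iteration over a nonempty family, as there is
   no empty intersection. *)
Fixpoint fold1 (A : Type) (op : A -> A -> A) (n : nat) :
    ('I_n.+1 -> A) -> A :=
  match n with
  | 0 => fun F => F ord0
  | _.+1 => fun F => op (F ord0) (fold1 op (fun i => F (lift ord0 i)))
  end.

Definition bigcap (n : nat) (t : 'I_n.+1 -> sty) : ty :=
  fold1 Cap (fun i => Str (t i)).

(* "Gamma, x : a" is [G.[x <- a]] with the side condition [x \notin domf G]. *)
Definition basis := {fmap nat -> ty}.

Definition basis_eq (G D : basis) : Prop :=
  forall x, match G.[? x], D.[? x] with
            | Some a, Some b => ty_eq a b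
            | None, None => True
            | _, _ => False
            end.

(* [G + D] is the union of finite maps [catf G D].  Its value at x is that of
   the only basis declaring x, unless both do. *)
Definition bjoin (G D : basis) : basis :=
  [fmap x : domf (G + D) =>
     match G.[? val x], D.[? val x] with
     | Some a, Some b => Cap a b
     | _, _ => (G + D) x
     end].

Definition bjoinc (R : pred resource) (G D : basis) : basis :=
  if R rc then G + D else bjoin G D.

(* [ty_conv] expresses that terms are taken up to alpha-conversion and types up
   to [ty_eq]. *)
Inductive typed (R : pred resource) : basis -> pterm -> sty -> Prop :=
| ty_axiw (G : basis) (x : nat) n (s : 'I_n.+1 -> sty) i :
    ~~ R rw -> x \notin domf G ->
    typed R G.[x <- bigcap s] (Var x) (s i)
| ty_axew (x : nat) n (s : 'I_n.+1 -> sty) i :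
    R rw -> typed R [fmap].[x <- bigcap s] (Var x) (s i)
| ty_arrI (G : basis) (x : nat) a M s :
    x \notin domf G -> typed R G.[x <- a] M s ->
    typed R G (Lam x M) (Arr a s)
| ty_arrE (G : basis) M N s n (t : 'I_n.+1 -> sty) (D : 'I_n.+1 -> basis) :
    typed R G M (Arr (bigcap t) s) ->
    (forall i, typed R (D i) N (t i)) ->
    (forall i j, domf (D i) = domf (D j)) ->
    (R rc -> [disjoint domf G & domf (fold1 bjoin D)]) ->
    typed R (bjoinc R G (fold1 bjoin D)) (App M N) s
| ty_cont (G : basis) (x y z : nat) a b M s :
    R rc -> x != y -> x \notin domf G -> y \notin domf G -> z \notin domf G ->
    typed R G.[x <- a].[y <- b] M s ->
    typed R G.[z <- Cap a b] (Con z x y M) s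
| ty_weak (G : basis) (x : nat) a M s :
    R rw -> x \notin domf G -> typed R G M s ->
    typed R G.[x <- a] (Wk x M) s
| ty_conv (G G' : basis) M M' s s' :
    typed R G M s -> basis_eq G G' -> alpha M M' -> sty_eq s s' ->
    typed R G' M' s'.

(* Main.v *)
(* Erasing weakenings and identifying contracted variables maps a term to a
   de Bruijn lambda-term with the same typings: a type for the erasure gives one
   for the term, each variable receiving the type of its image.  Every beta-step
   of the erasure is the image of a nonempty reduction of the term: contractions
   and weakenings above an abstraction are first moved below or out of it (or
   merged by gamma-omega_2), and then beta fires.  Hence the erasure of a
   strongly normalising term is strongly normalising, and a strongly normalising
   lambda-term is typeable with intersections by head expansion. *)
Require Import Defs.
From mathcomp Require Import all_boot.
From mathcomp Require Import finmap.
From mathcomp Require Import zify.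
From Stdlib Require Import Relation_Operators Operators_Properties.
From Stdlib Require Import ClassicalEpsilon.

Set Implicit Arguments.
Unset Strict Implicit.
Unset Printing Implicit Defensive.

(** * Intersection types for pure lambda-terms *)

(** Terms are representatives and substitution is a relation whose clauses apply only under the
    variable convention. A beta-step of the erasure is therefore matched after a change of
    representative, and the existence of a substitution has to be proved. The clause for a
    contracted variable substitutes again in the result of a substitution, which defeats plain
    structural induction. Erasure takes place in an environment of lambda-terms, so that
    substitution becomes an update and both names of a contraction share one value. Without explicit
    weakening a step may lose free variables; steps are tracked with an inclusion of free variables,
    and with its converse under explicit weakening, which keeps the surrounding term well formed.
    Strong normalisation, stated by infinite sequences modulo equivalence, is turned classically
    into accessibility for one reduction after any equivalence. Finally, an argument that beta
    erases must still be typed, so head expansion carries along the typeability of the argument of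
    the head redex. *)

Inductive tm :=
| tvar (k : nat)
| tlam (M : tm)
| tapp (M N : tm).

Definition scons (T : Type) (a : T) (f : nat -> T) (k : nat) : T :=
  if k is k'.+1 then f k' else a.

Fixpoint tren (r : nat -> nat) (M : tm) : tm :=
  match M with
  | tvar k => tvar (r k)
  | tlam N => tlam (tren (scons 0 (S \o r)) N)
  | tapp N P => tapp (tren r N) (tren r P)
  end.

Definition shift : tm -> tm := tren S.

Definition up (s : nat -> tm) : nat -> tm := scons (tvar 0) (shift \o s).

Fixpoint tsub (s : nat -> tm) (M : tm) : tm :=
  match M with
  | tvar k => s k
  | tlam N => tlam (tsub (up s) N)
  | tapp N P => tapp (tsub s N) (tsub s P)
  end.

Inductive beta : tm -> tm -> Prop :=
| b_root M N : beta (tapp (tlam M) N) (tsub (scons N tvar) M)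
| b_lam M M' : beta M M' -> beta (tlam M) (tlam M')
| b_appl M M' N : beta M M' -> beta (tapp M N) (tapp M' N)
| b_appr M N N' : beta N N' -> beta (tapp M N) (tapp M N').

Lemma eq_tren r r' M : r =1 r' -> tren r M = tren r' M.
Proof.
elim: M r r' => [k|M IH|M IHM N IHN] r r' e /=.
- by rewrite e.
- by rewrite (IH _ (scons 0 (S \o r'))) // => -[|k] //=; rewrite e.
- by rewrite (IHM _ _ e) (IHN _ _ e).
Qed.

Lemma eq_tsub s s' M : s =1 s' -> tsub s M = tsub s' M.
Proof.
elim: M s s' => [k|M IH|M IHM N IHN] s s' e /=.
- exact: e.
- by rewrite (IH _ (up s')) // => -[|k] //=; rewrite e.
- by rewrite (IHM _ _ e) (IHN _ _ e).
Qed.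

Lemma tren_tren r r' M : tren r (tren r' M) = tren (r \o r') M.
Proof.
elim: M r r' => [k|M IH|M IHM N IHN] r r' //=; last by rewrite IHM IHN.
by rewrite IH; congr tlam; apply: eq_tren => -[|k].
Qed.

Lemma tsub_tren s r M : tsub s (tren r M) = tsub (s \o r) M.
Proof.
elim: M s r => [k|M IH|M IHM N IHN] s r //=; last by rewrite IHM IHN.
by rewrite IH; congr tlam; apply: eq_tsub => -[|k].
Qed.

Lemma tren_tsub r s M : tren r (tsub s M) = tsub (tren r \o s) M.
Proof.
elim: M r s => [k|M IH|M IHM N IHN] r s //=; last by rewrite IHM IHN.
rewrite IH; congr tlam; apply: eq_tsub => -[|k] //=.
by rewrite /shift !tren_tren; apply: eq_tren.
Qed.

Lemma tsub_shift s M : tsub (up s) (shift M) = shift (tsub s M).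
Proof. by rewrite /shift tsub_tren tren_tsub. Qed.

Lemma tsub_var M : tsub tvar M = M.
Proof.
elim: M => [k|M IH|M IHM N IHN] //=; last by rewrite IHM IHN.
by rewrite -{2}IH; congr tlam; apply: eq_tsub => -[|k].
Qed.

Lemma tsub_scons_shift M N : tsub (scons N tvar) (shift M) = M.
Proof. by rewrite /shift tsub_tren -{2}(tsub_var M); apply: eq_tsub. Qed.

(** Strict types are compared syntactically, as leaves of an intersection; the equations of [ty_eq]
    enter only when the typing is transferred to the term. *)
Fixpoint tin (t : sty) (a : ty) : Prop :=
  match a with
  | Str s => t = s
  | Cap b c => tin t b \/ tin t c
  end.

(** Bases are total and shared by both premises of an application; the separation of variables that
    the resource rules require is recovered in [typed_erase]. *)
Inductive hastype : (nat -> ty) -> tm -> sty -> Prop :=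
| h_var G k t : tin t (G k) -> hastype G (tvar k) t
| h_lam G a M t : hastype (scons a G) M t -> hastype G (tlam M) (Arr a t)
| h_app G a M N t :
    hastype G M (Arr a t) -> (forall s, tin s a -> hastype G N s) ->
    hastype G (tapp M N) t.

Definition typeable (M : tm) : Prop := exists G t, hastype G M t.

Lemma has_weak (G D : nat -> ty) M t :
  (forall k s, tin s (G k) -> tin s (D k)) -> hastype G M t -> hastype D M t.
Proof.
move=> GD h; elim: h D GD => {G M t}.
- by move=> G k t h D GD; constructor; apply: GD.
- move=> G a M t _ IH D GD; constructor; apply: IH => -[|k] //= s.
  exact: GD.
- move=> G a M N t _ IHM _ IHN D GD.
  by apply: h_app (IHM _ GD) _ => s sa; apply: IHN.
Qed.

Lemma has_ren G M r t : hastype G (tren r M) t <-> hastype (G \o r) M t.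
Proof.
split.
- elim: M G r t => [k|M IH|M IHM N IHN] G r t /= h; inversion h; subst.
  + by constructor.
  + constructor; apply: has_weak (IH _ _ _ H1) => -[|k] //.
  + by apply: h_app (IHM _ _ _ H2) _ => s /H4 /IHN.
- elim: M G r t => [k|M IH|M IHM N IHN] G r t /= h; inversion h; subst.
  + by constructor.
  + constructor; apply: IH; apply: has_weak H1 => -[|k] //.
  + by apply: h_app (IHM _ _ _ H2) _ => s /H4 /IHN.
Qed.

Definition join (G D : nat -> ty) (k : nat) : ty := Cap (G k) (D k).

Lemma has_joinl G D M t : hastype G M t -> hastype (join G D) M t.
Proof. by apply: has_weak => k s h; left. Qed.

Lemma has_joinr G D M t : hastype D M t -> hastype (join G D) M t.
Proof. by apply: has_weak => k s h; right. Qed.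

Definition types (G : nat -> ty) (s : nat -> tm) (D : nat -> ty) : Prop :=
  forall k t, tin t (D k) -> hastype G (s k) t.

Lemma types_join G s D D' : types G s D -> types G s D' -> types G s (join D D').
Proof. by move=> h h' k t [/h|/h']. Qed.

(* [D0] provides a type for the variables that do not occur in [M]. *)
Lemma has_unsub M G s D0 t :
  types G s D0 -> hastype G (tsub s M) t ->
  exists2 D, types G s D & hastype D M t.
Proof.
elim: M G s D0 t => [k|M IH|M IHM N IHN] G s D0 t h0 /= h.
- exists (fun j => if j == k then Str t else D0 j).
    by move=> j u; case: eqP => [->|_] /=; [move=> -> | exact: h0].
  by constructor; rewrite eqxx.
- inversion h; subst.
  have [|D hD hM] := IH (scons a G) (up s) (scons a D0) _ _ H1.
    by case=> [|k] u /=; [move=> ua; constructor | move=> /h0 ?; apply/has_ren].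
  exists (D \o S); first by move=> k u /(hD k.+1) /has_ren.
  (* [up s] sends 0 to itself, so each leaf of [D 0] is the type of a variable declared [a], hence a
     leaf of [a]. *)
  constructor; apply: has_weak hM => -[|k] //= u /(hD 0) /= hu.
  by inversion hu.
- inversion h; subst.
  have [D hD hM] := IHM _ _ _ _ h0 H2.
  (* The argument yields one basis for each leaf of [a]; they are joined along the structure of
     [a]. *)
  have [D' hD' hN] : exists2 D', types G s D' & forall u, tin u a -> hastype D' N u.
    elim: a H4 {H2 hM} => [u|a IHa b IHb] H4.
      have [//|D' hD' hN] := IHN _ _ _ u h0 (H4 _ _).
      by exists D' => // v ->.
    have [u ua|D1 h1 h1'] := IHa; first by apply: H4; left.
    have [u ub|D2 h2 h2'] := IHb; first by apply: H4; right.
    exists (join D1 D2); first exact: types_join.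
    by move=> u [/h1'|/h2'] ?; [apply: has_joinl | apply: has_joinr].
  exists (join D D'); first exact: types_join.
  apply: (h_app (a := a)); first exact: has_joinl.
  by move=> u /hN; apply: has_joinr.
Qed.

(** Weak head reduction, indexed by the argument [A] of the contracted redex because expansion needs
    a type for it. *)
Inductive hred (A : tm) : tm -> tm -> Prop :=
| hr_root M : hred A (tapp (tlam M) A) (tsub (scons A tvar) M)
| hr_app M M' N : hred A M M' -> hred A (tapp M N) (tapp M' N).

(** If the bound variable does not occur, the contractum says nothing about [A]. The basis of [A] is
    therefore joined to [G], and its type is the default offered to [has_unsub]. *)
Lemma hred_expand A M M' : hred A M M' -> typeable A ->
  forall G t, hastype G M' t -> exists2 D, (forall k s, tin s (G k) ->
    tin s (D k)) & hastype D M t.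
Proof.
move=> h [GA [tA hA]]; elim: h => {M M'}.
- move=> M G t hM.
  have hA' := has_joinr G hA.
  have [||D hD hMD] := @has_unsub M (join G GA) (scons A tvar) (scons (Str tA) (join G
    GA)) t.
  + by move=> [|k] u /=; [move=> -> | move=> hu; constructor].
  + exact: has_joinl.
  exists (join G GA); first by move=> k s; left.
  apply: (h_app (a := D 0)); last exact: (hD 0).
  constructor; apply: has_weak hMD => -[|k] // u /(hD k.+1) /= hu.
  by inversion hu.
- move=> M M' N _ IH G t h; inversion h; subst.
  have [D GD hM] := IH _ _ H2.
  exists D => //; apply: h_app hM _ => s /H4.
  exact: has_weak.
Qed.

(** The head variable can be given any arrow type, so such a term has every strict type once its
    arguments are typeable. *)
Inductive neutral : tm -> Prop :=
| ne_var k : neutral (tvar k)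
| ne_app M N : neutral M -> typeable N -> neutral (tapp M N).

Lemma neutral_typeable M t : neutral M -> exists G, hastype G M t.
Proof.
move=> h; elim: h t => {M} [k|M N _ IH [D [s hN]]] t.
  by exists (fun=> Str t); constructor.
have [G hM] := IH (Arr (Str s) t).
exists (join G D); apply: (h_app (a := Str s)); first exact: has_joinl.
by move=> u /= ->; apply: has_joinr.
Qed.

Inductive subterm : tm -> tm -> Prop :=
| st_refl M : subterm M M
| st_lam M N : subterm M N -> subterm M (tlam N)
| st_appl M N P : subterm M N -> subterm M (tapp N P)
| st_appr M N P : subterm M P -> subterm M (tapp N P).

Lemma subterm_trans M N P : subterm M N -> subterm N P -> subterm M P.
Proof.
move=> h h'; elim: h' M h => // {N P} *.
- by apply: st_lam; auto.
- by apply: st_appl; auto.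
- by apply: st_appr; auto.
Qed.

Lemma subterm_beta N M N' : subterm N M -> beta N N' ->
  exists2 M', beta M M' & subterm N' M'.
Proof.
move=> h; elim: h N' => {N M}.
- by move=> M N' h; exists N' => //; constructor.
- by move=> M N _ IH M' /IH[N' ? ?]; exists (tlam N'); constructor.
- by move=> M N P _ IH M' /IH[N' ? ?]; exists (tapp N' P); constructor.
- by move=> M N P _ IH M' /IH[N' ? ?]; exists (tapp N N'); constructor.
Qed.

Lemma hred_beta A M M' : hred A M M' -> beta M M'.
Proof. by elim=> *; constructor. Qed.

(** The outer induction, on accessibility, treats all subterms at once: the head reduct of a subterm
    is a subterm of a reduct. The inner one is structural and records the shape of a subterm
    (abstraction, neutral, or head-reducible with a typeable argument), as the shape of the function
    decides how an application is typed. *)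
Lemma sn_typeable M : Acc (fun N N' => beta N' N) M -> typeable M.
Proof.
move=> hM; suff: forall N, subterm N M -> typeable N by apply; constructor.
elim: hM => {}M _ IH N NM.
suff [] : typeable N /\
    [\/ exists P, N = tlam P, neutral N | exists A N', hred A N N' /\ typeable A] by [].
elim: N NM => [k|N IHN|N IHN P IHP] NM.
- have h : neutral (tvar k) by constructor.
  split; last by constructor 2.
  by have [G hG] := neutral_typeable (Atom 0) h; exists G, (Atom 0).
- have [|[G [t h]] _] := IHN.
    by apply: subterm_trans NM; do 2! constructor.
  split; last by constructor 1; exists N.
  exists (G \o S), (Arr (G 0) t); constructor.
  by apply: has_weak h => -[|k].
- have [|tN sN] := IHN; first by apply: subterm_trans NM; do 2! constructor.
  have [|tP _] := IHP.
    by apply: subterm_trans NM; apply: st_appr; constructor.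
  have hr A N' : hred A (tapp N P) N' -> typeable A -> typeable (tapp N P).
    move=> h tA; have [M' MM' N'M'] := subterm_beta NM (hred_beta h).
    have [G [t ht]] := IH _ MM' _ N'M'.
    by have [D _ hD] := hred_expand h tA ht; exists D, t.
  case: sN => [[Q eN]|nN|[A [N' [h tA]]]].
  + have h : hred P (tapp N P) (tsub (scons P tvar) Q) by rewrite eN; constructor.
    by split; [apply: hr h _ | constructor 3; exists P, (tsub (scons P tvar) Q)].
  + have h : neutral (tapp N P) by constructor.
    split; last by constructor 2.
    by have [G hG] := neutral_typeable (Atom 0) h; exists G, (Atom 0).
  + have h' : hred A (tapp N P) (tapp N' P) by constructor.
    by split; [apply: hr h' _ | constructor 3; exists A, (tapp N' P)].
Qed.

Local Open Scope fset_scope.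

(** * Erasure, renaming and alpha-conversion *)

(* [lia] needs [==] at [nat_eqType] and a single form of the membership atoms,
   which the canonical structures of [finmap] do not give. *)
Definition inb (z : nat) (A : {fset nat}) : bool := z \in A.

Lemma inb_fset1 (x z : nat) : inb z [fset x] = (z == x).
Proof. by rewrite /inb !inE. Qed.

Lemma inb_fset2 (x y z : nat) : inb z [fset x; y] = (z == x) || (z == y).
Proof. by rewrite /inb !inE. Qed.

Lemma inb_fset1U (A : {fset nat}) (x z : nat) : inb z (x |` A) = (z == x) || inb z A.
Proof. by rewrite /inb !inE. Qed.

Lemma inb_fsetD1 (A : {fset nat}) (x z : nat) : inb z (A `\ x) = (z != x) && inb z A.
Proof. by rewrite /inb !inE. Qed.

Lemma inb_fsetU (A B : {fset nat}) (z : nat) : inb z (A `|` B) = inb z A || inb z B.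
Proof. by rewrite /inb !inE. Qed.

Lemma inb_fsetI (A B : {fset nat}) (z : nat) : inb z (A `&` B) = inb z A && inb z B.
Proof. by rewrite /inb !inE. Qed.

Lemma inb_fsetD (A B : {fset nat}) (z : nat) : inb z (A `\` B) = ~~ inb z B && inb z A.
Proof. by rewrite /inb !inE. Qed.

Lemma inb_fset0 (z : nat) : inb z fset0 = false.
Proof. by rewrite /inb !inE. Qed.

Lemma inbE z (A : {fset nat}) : z \in A = inb z A.
Proof. by []. Qed.

Lemma fset_eqI (A B : {fset nat}) :
  (forall z : nat, inb z A = inb z B) -> A = B.
Proof. by move=> h; apply/fsetP => z; apply: h. Qed.

Lemma fset_subI (A B : {fset nat}) :
  (forall z : nat, inb z A -> inb z B) -> A `<=` B.
Proof. by move=> h; apply/fsubsetP => z; apply: h. Qed.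

Lemma fset_disjI (A B : {fset nat}) :
  (forall z : nat, inb z A -> ~~ inb z B) -> [disjoint A & B].
Proof. by move=> h; apply/fdisjointP => z; apply: h. Qed.

Lemma inb_sub (A B : {fset nat}) (z : nat) : A `<=` B -> inb z A ==> inb z B.
Proof. by move=> /fsubsetP h; apply/implyP/h. Qed.

Lemma inb_disj (A B : {fset nat}) (z : nat) :
  [disjoint A & B] -> ~~ (inb z A && inb z B).
Proof. by move=> /fdisjointP h; apply/negP => /andP[/h /negP]. Qed.

Definition upd (T : Type) (f : nat -> T) (x : nat) (a : T) (y : nat) : T :=
  if y == x then a else f y.

(** Values are terms rather than indices, so that the erasure of M[N/x] is that of M in an updated
    environment. *)
Fixpoint erase (rho : nat -> tm) (f : pterm) : tm :=
  match f with
  | Var x => rho x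
  | Lam x g => tlam (erase (upd (shift \o rho) x (tvar 0)) g)
  | App g h => tapp (erase rho g) (erase rho h)
  | Con x x1 x2 g => erase (upd (upd rho x1 (rho x)) x2 (rho x)) g
  | Wk _ g => erase rho g
  end.

(* A contraction of two variables that are not free has an idle name, which
   alpha-conversion treats as bound. *)
Definition idle (x1 x2 : nat) (f : pterm) : bool :=
  (x1 \notin fv f) && (x2 \notin fv f).

(** Counting the names of idle contractions as bound makes every name either free or bound
    ([namesE]) and marks all that [freshen] must rename. *)
Fixpoint bn (f : pterm) : {fset nat} :=
  match f with
  | Var x => fset0
  | Lam x g => x |` bn g
  | App g h => bn g `|` bn h
  | Con x x1 x2 g =>
      [fset x1; x2] `|` (if idle x1 x2 g then x |` bn g else bn g)
  | Wk x g => bn g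
  end.

(** No name is bound at two places. Disjointness from free variables is stated separately, relative
    to a set of names to avoid. *)
Fixpoint barendregt (f : pterm) : bool :=
  match f with
  | Var x => true
  | Lam x g => (x \notin bn g) && barendregt g
  | App g h => [&& [disjoint bn g & bn h]%fset, barendregt g & barendregt h]
  | Con x x1 x2 g =>
      [&& x1 \notin bn g, x2 \notin bn g,
          idle x1 x2 g ==> [&& x != x1, x != x2 & x \notin bn g] & barendregt g]
  | Wk x g => barendregt g
  end.

Definition inb_set := (inb_fset1, inb_fset2, inb_fset1U, inb_fsetD1, inb_fsetU,
  inb_fsetI, inb_fsetD, inb_fset0).

Lemma fv_con (x x1 x2 : nat) f (z : nat) :
  inb z (fv (Con x x1 x2 f)) =
  (z == x) && ~~ idle x1 x2 f || [&& inb z (fv f), z != x1 & z != x2].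
Proof.
rewrite /= /idle -!/(inb _ _); case: ifP => h; rewrite ?inb_set; last by lia.
by case: (z =P x1) => [zx|_]; case: (z =P x2) => [zx'|_]; subst; lia.
Qed.

Lemma bn_con (x x1 x2 : nat) f (z : nat) :
  inb z (bn (Con x x1 x2 f)) =
  [|| z == x1, z == x2, (z == x) && idle x1 x2 f | inb z (bn f)].
Proof. by rewrite /=; case: idle; rewrite ?inb_set; lia. Qed.

Lemma fv_var (x z : nat) : inb z (fv (Var x)) = (z == x).
Proof. exact: inb_fset1. Qed.

Lemma fv_lam (x : nat) f (z : nat) :
  inb z (fv (Lam x f)) = (z != x) && inb z (fv f).
Proof. exact: inb_fsetD1. Qed.

Lemma fv_app f g (z : nat) : inb z (fv (App f g)) = inb z (fv f) || inb z (fv g).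
Proof. exact: inb_fsetU. Qed.

Lemma fv_wk (x : nat) f (z : nat) : inb z (fv (Wk x f)) = (z == x) || inb z (fv f).
Proof. exact: inb_fset1U. Qed.

Lemma bn_var (x z : nat) : inb z (bn (Var x)) = false.
Proof. exact: inb_fset0. Qed.

Lemma bn_lam (x : nat) f (z : nat) :
  inb z (bn (Lam x f)) = (z == x) || inb z (bn f).
Proof. exact: inb_fset1U. Qed.

Lemma bn_app f g (z : nat) : inb z (bn (App f g)) = inb z (bn f) || inb z (bn g).
Proof. exact: inb_fsetU. Qed.

Lemma bn_wk (x : nat) f (z : nat) : inb z (bn (Wk x f)) = inb z (bn f).
Proof. by []. Qed.

Definition inb_fv := (fv_con, fv_var, fv_lam, fv_app, fv_wk,
  bn_con, bn_var, bn_lam, bn_app, bn_wk).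

Lemma namesE f (z : nat) : inb z (names f) = inb z (fv f) || inb z (bn f).
Proof.
elim: f => [x|x f IH|f IHf g IHg|x x1 x2 f IH|x f IH];
  by rewrite ?inb_fv /= ?inb_set ?IH ?IHf ?IHg; lia.
Qed.

Definition inN := (inb_set, inb_fv, namesE).

(** Membership in [fv], [bn] and [names] becomes a Boolean combination of equalities and [inb]
    atoms, settled by [lia] or by cases on the atoms. *)
Ltac to_inb := repeat match goal with
  | |- context [@in_mem ?T ?z (@mem ?U ?P ?A)] =>
      change (@in_mem T z (@mem U P A)) with (inb z A)
  | H : context [@in_mem ?T ?z (@mem ?U ?P ?A)] |- _ =>
      change (@in_mem T z (@mem U P A)) with (inb z A) in H
  end.

Ltac eqcases := repeat (match goal with
  | |- context [@eq_op _ ?a ?b] =>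
      lazymatch a with context [@eq_op] => fail | _ => idtac end;
      case: (@eqP _ a b) => [?|?]; subst
  end; rewrite /= ?eqxx /= => //).

Ltac boolcases := repeat (match goal with
  | |- context [inb ?a ?b] => case: (inb a b)
  end; rewrite /= ?andbF ?andbT ?orbF ?orbT => //).

Ltac setnorm := to_inb; rewrite ?inN /idle; to_inb; rewrite ?inN.

Ltac setlia := setnorm; lia.

Ltac eqlia := setnorm; eqcases; boolcases; try lia.

Lemma eq_erase rho rho' f :
  (forall x, x \in fv f -> rho x = rho' x) -> erase rho f = erase rho' f.
Proof.
elim: f rho rho' => [x|x f IH|f IHf g IHg|x x1 x2 f IH|x f IH] rho rho' e; rewrite /=.
- by apply: e; setlia.
- congr tlam; apply: IH => y yf; rewrite /upd; case: eqP => // /eqP yx /=.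
  by rewrite e //; setlia.
- by congr tapp; [apply: IHf | apply: IHg] => x xf; apply: e; setlia.
- apply: IH => y yf; rewrite /upd; case: (y =P x2) => [yx2|yx2];
  last case: (y =P x1) => [yx1|yx1].
  + by subst y; apply: e; setlia.
  + by subst y; apply: e; setlia.
  + by apply: e; setlia.
- by apply: IH => y yf; apply: e; setlia.
Qed.

Lemma tsub_erase s rho f : tsub s (erase rho f) = erase (tsub s \o rho) f.
Proof.
elim: f s rho => [x|x f IH|f IHf g IHg|x x1 x2 f IH|x f IH] s rho //=.
- rewrite IH; congr tlam; apply: eq_erase => y _.
  by rewrite /upd /=; case: eqP => //= _; rewrite tsub_shift.
- by rewrite IHf IHg.
- rewrite IH; apply: eq_erase => y _.
  by rewrite /upd /=; do 2! case: eqP => //.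
Qed.

Lemma shift_erase rho f : shift (erase rho f) = erase (shift \o rho) f.
Proof.
have shE M : shift M = tsub (tvar \o S) M by rewrite -tsub_tren tsub_var.
by rewrite shE tsub_erase; apply: eq_erase => x _; rewrite /= shE.
Qed.

Section InjectiveRenaming.
Variables (r : nat -> nat) (r_inj : injective r).

Lemma names_ren f : names (ren r f) = [fset r z | z in names f].
Proof.
elim: f => [x|x f IH|f IHf g IHg|x x1 x2 f IH|x f IH] /=.
- by rewrite imfset_fset1.
- by rewrite imfsetU imfset_fset1 IH.
- by rewrite imfsetU IHf IHg.
- by rewrite !imfsetU !imfset_fset1 IH.
- by rewrite imfsetU imfset_fset1 IH.
Qed.

Lemma mem_fv_ren f (y : nat) : inb (r y) (fv (ren r f)) = inb y (fv f).
Proof.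
have rE (u v : nat) : (r u == r v) = (u == v) by exact: inj_eq.
elim: f y => [x|x f IH|f IHf g IHg|x x1 x2 f IH|x f IH] y;
  by rewrite [ren _ _]/= ?inN /idle -?/(inb _ _) ?rE ?IH ?IHf ?IHg.
Qed.

Lemma idle_ren x1 x2 f : idle (r x1) (r x2) (ren r f) = idle x1 x2 f.
Proof. by rewrite /idle !inbE !mem_fv_ren. Qed.

Lemma fv_renP f : fv (ren r f) = [fset r z | z in fv f].
Proof.
apply/fsetP => z; apply/idP/imfsetP => [zf|[y /= yf ->]]; last by rewrite inbE mem_fv_ren.
have : inb z (names (ren r f)) by rewrite namesE /inb zf.
by rewrite names_ren => /imfsetP[y /= _ e]; exists y => //; rewrite inbE -mem_fv_ren -e.
Qed.

Lemma mem_bn_ren f (y : nat) : inb (r y) (bn (ren r f)) = inb y (bn f).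
Proof.
have rE (u v : nat) : (r u == r v) = (u == v) by exact: inj_eq.
elim: f y => [x|x f IH|f IHf g IHg|x x1 x2 f IH|x f IH] y;
  by rewrite [ren _ _]/= ?inN ?idle_ren ?rE ?IH ?IHf ?IHg.
Qed.

Lemma bn_renP f : bn (ren r f) = [fset r z | z in bn f].
Proof.
apply/fsetP => z; apply/idP/imfsetP => [zf|[y /= yf ->]]; last by rewrite inbE mem_bn_ren.
have : inb z (names (ren r f)) by rewrite namesE /inb zf orbT.
by rewrite names_ren => /imfsetP[y /= _ e]; exists y => //; rewrite inbE -mem_bn_ren -e.
Qed.

Lemma disjoint_imfset (A B : {fset nat}) :
  [disjoint [fset r z | z in A] & [fset r z | z in B]] = [disjoint A & B].
Proof.
apply/fdisjointP/fdisjointP => h z.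
  move=> zA; apply/negP => zB; have /negP := h (r z) (in_imfset _ _ zA); apply.
  exact: in_imfset.
case/imfsetP => y /= /h yB ->; apply/negP => /imfsetP[u /= uB /r_inj e].
by rewrite e uB in yB.
Qed.

Lemma barendregt_ren f : barendregt (ren r f) = barendregt f.
Proof.
elim: f => [x|x f IH|f IHf g IHg|x x1 x2 f IH|x f IH] //=.
- by rewrite inbE mem_bn_ren IH.
- by rewrite IHf IHg !bn_renP disjoint_imfset.
- by rewrite idle_ren !inbE !mem_bn_ren IH !inj_eq.
Qed.

Lemma lterm_ren R f : lterm R f -> lterm R (ren r f).
Proof.
elim => {f} /=.
- by constructor.
- by move=> x f _ IH h; constructor => // /h; rewrite !inbE mem_fv_ren.
- move=> f g _ IHf _ IHg h; constructor => // /h.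
  by rewrite !fv_renP disjoint_imfset.
- by move=> x f rw _ IH xf; constructor => //; rewrite inbE mem_fv_ren.
- move=> x x1 x2 f c _ IH ne xf h; constructor => //; rewrite ?inj_eq //.
  + by move: xf; to_inb; rewrite ?inN !inj_eq // mem_fv_ren.
  + by rewrite !inbE !mem_fv_ren.
Qed.

Lemma erase_ren rho f : erase rho (ren r f) = erase (rho \o r) f.
Proof.
elim: f rho => [x|x f IH|f IHf g IHg|x x1 x2 f IH|x f IH] rho //=.
- rewrite IH; congr tlam; apply: eq_erase => y _.
  by rewrite /upd /= inj_eq.
- by rewrite IHf IHg.
- rewrite IH; apply: eq_erase => y _.
  by rewrite /upd /= !inj_eq.
Qed.

End InjectiveRenaming.

(** * Renamings injective on a finite set, swaps and fresh names *)

Lemma eq_ren (r r' : nat -> nat) f : (forall x, x \in names f -> r x = r' x) ->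
  ren r f = ren r' f.
Proof.
elim: f => [x|x f IH|f IHf g IHg|x x1 x2 f IH|x f IH] /= h;
  rewrite ?h ?IH ?IHf ?IHg // ?inE ?eqxx ?orbT // => y yf; apply: h;
  by rewrite ?inE yf ?orbT.
Qed.

Lemma fresh_nat (s : seq nat) : exists m, forall z, z \in s -> z < m.
Proof.
exists (\max_(z <- s) z).+1 => z zs; rewrite ltnS.
by rewrite (big_rem z) //= leq_maxl.
Qed.

(** Outside [A] variables move beyond a bound [m] of the values on [A]. A freshening renaming is
    injective only on the names at hand; the extension makes the lemmas on injective renamings
    applicable to it. *)
Lemma injective_extension (r : nat -> nat) (A : {fset nat}) : {in A &, injective r} ->
  exists2 r', injective r' & forall x, x \in A -> r x = r' x.
Proof.
move=> h; have [m hm] := fresh_nat [fset r z | z in A].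
have hm' z : z \in A -> r z < m by move=> zA; apply: hm; apply: in_imfset.
exists (fun z => if z \in A then r z else (z + m)%N); last by move=> z ->.
move=> y z; case: ifP => yA; case: ifP => zA; first exact: h.
- by have := hm' _ yA; lia.
- by have := hm' _ zA; lia.
- by lia.
Qed.

Lemma swap_inj (a b : nat) : injective (fun x : nat => if x == a then b else if x == b
  then a else x).
Proof.
move=> y z; case: (y =P a); case: (z =P a); case: (y =P b); case: (z =P b);
  congruence.
Qed.

Lemma fv_swap (a y : nat) M (z : nat) : y \notin names M ->
  inb z (fv (swap a y M)) =
  (z == y) && inb a (fv M) || inb z (fv M) && (z != a).
Proof.
rewrite inbE namesE => yM; have yM' : ~~ inb y (fv M) by lia.
have swE (u v : nat) : u = (if v == a then y else if v == y then a else v) ->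
  inb u (fv (swap a y M)) = inb v (fv M).
  by move=> ->; rewrite /swap mem_fv_ren //; apply: swap_inj.
case: (z =P y) => [->|zy].
  by rewrite (swE y a) ?eqxx // (negPf yM') /= orbF.
case: (z =P a) => [->|za].
  by rewrite (swE a y) ?eqxx ?(negPf yM') ?andbF //; case: eqP.
by rewrite (swE z z) ?andbT //; case: eqP => // _; case: eqP.
Qed.

Lemma bn_swap (a y : nat) M (z : nat) : y \notin names M ->
  inb z (bn (swap a y M)) =
  (z == y) && inb a (bn M) || inb z (bn M) && (z != a).
Proof.
rewrite inbE namesE => yM; have yM' : ~~ inb y (bn M) by lia.
have swE (u v : nat) : u = (if v == a then y else if v == y then a else v) ->
  inb u (bn (swap a y M)) = inb v (bn M).
  by move=> ->; rewrite /swap mem_bn_ren //; apply: swap_inj.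
case: (z =P y) => [->|zy].
  by rewrite (swE y a) ?eqxx // (negPf yM') /= orbF.
case: (z =P a) => [->|za].
  by rewrite (swE a y) ?eqxx ?(negPf yM') ?andbF //; case: eqP.
by rewrite (swE z z) ?andbT //; case: eqP => // _; case: eqP.
Qed.

Lemma fresh_name (A : {fset nat}) : exists y : nat, y \notin A.
Proof.
have [m hm] := fresh_nat A; exists m; apply/negP => /hm; by rewrite ltnn.
Qed.

(** What a change of representative preserves. Equality of erasures lets such changes be inserted
    anywhere in the simulation. *)
Definition same (R : pred resource) (f g : pterm) : Prop :=
  [/\ alpha f g, lterm R g, fv g = fv f & forall rho, erase rho g = erase rho f].

Lemma same_refl R f : lterm R f -> same R f f.
Proof. by move=> h; split=> //; apply: rst_refl. Qed.

Lemma same_trans R f g h : same R f g -> same R g h -> same R f h.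
Proof.
move=> [a1 l1 f1 e1] [a2 l2 f2 e2]; split=> //; first exact: rst_trans a1 a2.
  by rewrite f2.
by move=> rho; rewrite e2.
Qed.

Lemma crst_compat (r : pterm -> pterm -> Prop) (C : pterm -> pterm) :
  (forall f g, compat r f g -> compat r (C f) (C g)) ->
  forall f g, clos_refl_sym_trans _ (compat r) f g ->
  clos_refl_sym_trans _ (compat r) (C f) (C g).
Proof.
move=> hC f g; elim=> {f g}.
- by move=> f g h; apply: rst_step; apply: hC.
- by move=> f; apply: rst_refl.
- by move=> f g _; apply: rst_sym.
- by move=> f g h _ fg _; apply: rst_trans fg.
Qed.

Lemma lterm_lam R x f : lterm R (Lam x f) -> lterm R f /\ (R rw -> x \in fv f).
Proof. by move=> h; inversion h. Qed.

Lemma lterm_app R f g : lterm R (App f g) ->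
  [/\ lterm R f, lterm R g & R rc -> [disjoint fv f & fv g]].
Proof. by move=> h; inversion h. Qed.

Lemma lterm_wk R x f : lterm R (Wk x f) -> [/\ R rw, lterm R f & x \notin fv f].
Proof. by move=> h; inversion h. Qed.

Lemma lterm_con R x x1 x2 f : lterm R (Con x x1 x2 f) ->
  [/\ R rc, lterm R f & [/\ x1 != x2, x \notin fv f `\` [fset x1; x2] &
    R rw -> (x1 \in fv f) && (x2 \in fv f)]].
Proof. by move=> h; inversion h. Qed.

Lemma same_lam R x f g : same R f g -> lterm R (Lam x f) ->
  same R (Lam x f) (Lam x g).
Proof.
move=> [a l e h] /lterm_lam[_ xf]; split.
- by apply: (crst_compat (C := Lam x)) a => *; apply: cp_lam.
- by constructor; rewrite ?e.
- by rewrite /= e.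
- by move=> rho /=; rewrite h.
Qed.

Lemma same_app R f g f' g' : same R f f' -> same R g g' -> lterm R (App f g) ->
  same R (App f g) (App f' g').
Proof.
move=> [a l e h] [a' l' e' h'] /lterm_app[_ _ d]; split.
- apply: rst_trans.
    by apply: (crst_compat (C := App^~ g)) a => *; apply: cp_appl.
  by apply: (crst_compat (C := App f')) a' => *; apply: cp_appr.
- by constructor; rewrite ?e ?e'.
- by rewrite /= e e'.
- by move=> rho /=; rewrite h h'.
Qed.

Lemma same_con R x x1 x2 f g : same R f g -> lterm R (Con x x1 x2 f) ->
  same R (Con x x1 x2 f) (Con x x1 x2 g).
Proof.
move=> [a l e h] /lterm_con[c _ [ne xf d]]; split.
- by apply: (crst_compat (C := Con x x1 x2)) a => *; apply: cp_con.
- by constructor; rewrite ?e.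
- by rewrite /= e.
- by move=> rho /=; rewrite h.
Qed.

Lemma same_wk R x f g : same R f g -> lterm R (Wk x f) ->
  same R (Wk x f) (Wk x g).
Proof.
move=> [a l e h] /lterm_wk[c _ xf]; split.
- by apply: (crst_compat (C := Wk x)) a => *; apply: cp_wk.
- by constructor; rewrite ?e.
- by rewrite /= e.
- by move=> rho /=; rewrite h.
Qed.

Lemma same_lam_swap R (x y : nat) M : lterm R (Lam x M) -> y \notin names M ->
  same R (Lam x M) (Lam y (swap x y M)).
Proof.
move=> /lterm_lam[lM xM] yM; have := yM; rewrite inbE namesE => yM'; split.
- by apply: rst_step; apply: cp_base; constructor.
- constructor; first by apply: lterm_ren => //; apply: swap_inj.
  by move=> /xM; rewrite !inbE fv_swap // eqxx => ->.
- apply: fset_eqI => z; move: (fv_swap x z yM) yM'; eqlia.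
- move=> rho /=; rewrite /swap erase_ren; last exact: swap_inj.
  congr tlam; apply: eq_erase => z zM; rewrite /upd /=.
  case: (z =P x) => [|_]; first by rewrite eqxx.
  case: (z =P y) => [zy|]; last by case: eqP.
  by move: yM'; rewrite -zy /inb zM.
Qed.

Lemma same_con_swap1 R (x x1 x2 y : nat) M : lterm R (Con x x1 x2 M) ->
  y \notin names M -> y != x2 -> y != x ->
  same R (Con x x1 x2 M) (Con x y x2 (swap x1 y M)).
Proof.
move=> /lterm_con[c lM [ne xM h]] yM yx2 yx; have := yM; rewrite inbE namesE => yM'.
have swE z := fv_swap x1 z yM; split.
- by apply: rst_step; apply: cp_base; constructor.
- constructor => //; first by apply: lterm_ren => //; apply: swap_inj.
  + by move: xM; to_inb; rewrite ?inN swE; lia.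
  + by move=> /h; setnorm; rewrite !swE; lia.
- apply: fset_eqI => z; setnorm; rewrite !swE; move: xM yM' ne yx2.
  by eqlia.
- move=> rho /=; rewrite /swap erase_ren; last exact: swap_inj.
  apply: eq_erase => z zM; rewrite /upd /=.
  have zy : z != y by apply: contraNneq yM' => <-; rewrite -inbE zM.
  rewrite (negPf zy); case: (z =P x1) => [->|zx1].
    by rewrite (negPf yx2) eqxx (negPf ne).
  by rewrite (negPf zy).
Qed.

Lemma same_con_swap2 R (x x1 x2 y : nat) M : lterm R (Con x x1 x2 M) ->
  y \notin names M -> y != x1 -> y != x ->
  same R (Con x x1 x2 M) (Con x x1 y (swap x2 y M)).
Proof.
move=> /lterm_con[c lM [ne xM h]] yM yx1 yx; have := yM; rewrite inbE namesE => yM'.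
have swE z := fv_swap x2 z yM; split.
- by apply: rst_step; apply: cp_base; constructor.
- constructor => //; first by apply: lterm_ren => //; apply: swap_inj.
  + by rewrite eq_sym.
  + by move: xM; to_inb; rewrite ?inN swE; lia.
  + by move=> /h; setnorm; rewrite !swE; lia.
- apply: fset_eqI => z; setnorm; rewrite !swE; move: xM yM' ne yx1.
  by eqlia.
- move=> rho /=; rewrite /swap erase_ren; last exact: swap_inj.
  apply: eq_erase => z zM; rewrite /upd /=.
  have zy : z != y by apply: contraNneq yM' => <-; rewrite -inbE zM.
  rewrite (negPf zy); case: (z =P x2) => [_|_].
    by rewrite eqxx.
  by rewrite (negPf zy).
Qed.

Lemma same_con_idle R (x x1 x2 y : nat) M : lterm R (Con x x1 x2 M) ->
  idle x1 x2 M -> y \notin fv M -> same R (Con x x1 x2 M) (Con y x1 x2 M).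
Proof.
move=> /lterm_con[c lM [ne xM h]] iM yM; move: (iM) => /andP[x1M x2M].
have xM' : x \notin fv M by move: xM x1M x2M; eqlia.
split.
- by apply: rst_step; apply: cp_base; constructor.
- by constructor => //; move: yM; eqlia.
- by apply: fset_eqI => z; rewrite !fv_con iM /= !andbF.
- move=> rho /=; apply: eq_erase => z zM; rewrite /upd.
  case: eqP => [e|_]; first by rewrite -e zM in x2M.
  by case: eqP => [e|_] //; rewrite -e zM in x1M.
Qed.

(** Binders are renamed from the inside outwards, each to a name outside [A] and outside the names
    of the body reached so far. *)
Lemma freshen R M : lterm R M -> forall A : {fset nat}, exists M0,
  [/\ same R M M0, [disjoint bn M0 & A] & barendregt M0].
Proof.
elim: M => [x|x f IH|f IHf g IHg|x x1 x2 f IH|x f IH] lM A.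
- exists (Var x); split=> //; first exact: same_refl.
  by apply: fset_disjI => z; eqlia.
- have [lf xf] := lterm_lam lM.
  (* The binders of the body also avoid [x], so that swapping [x] with a fresh name leaves them
     unchanged. *)
  have [f0 [s0 d0 b0]] := IH lf (x |` A).
  have [y hy] := fresh_name (names f0 `|` A).
  have sl := same_lam s0 lM; have [_ l0 _ _] := sl.
  have yf : y \notin names f0 by move: hy; eqlia.
  have yA : y \notin A by move: hy; eqlia.
  have bE z := bn_swap x z yf.
  exists (Lam y (swap x y f0)); split.
  + exact: same_trans sl (same_lam_swap l0 yf).
  + apply: fset_disjI => z; setnorm; rewrite bE.
    by move: (inb_disj z d0) yA; eqlia.
  + rewrite /= inbE bE eqxx /= /swap barendregt_ren ?b0; last exact: swap_inj.
    by move: yf (inb_disj x d0); eqlia.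
- have [lf lg d] := lterm_app lM.
  have [f0 [sf df bf]] := IHf lf A.
  (* The argument also avoids the binders of the function, so that no name is bound on both
     sides. *)
  have [g0 [sg dg bg]] := IHg lg (A `|` bn f0).
  exists (App f0 g0); split.
  + exact: same_app.
  + apply: fset_disjI => z; move: (inb_disj z df) (inb_disj z dg); eqlia.
  + rewrite /= bf bg !andbT.
    by apply: fset_disjI => z; move: (inb_disj z dg); eqlia.
- have [c lf _] := lterm_con lM.
  have [f0 [s0 d0 b0]] := IH lf ([fset x1; x2] `|` A).
  have [y1 hy1] := fresh_name ([fset x; x1; x2] `|` names f0 `|` A).
  have yf : y1 \notin names f0 by move: hy1; eqlia.
  have b1 z := bn_swap x1 z yf.
  have s1 := same_con s0 lM; have [_ l1 _ _] := s1.
  have s2 : same R (Con x x1 x2 f0) (Con x y1 x2 (swap x1 y1 f0)).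
    by apply: same_con_swap1 => //; move: hy1; eqlia.
  set f1 := swap x1 y1 f0 in b1 s2; have [_ l2 _ _] := s2.
  have [y2 hy2] := fresh_name ([fset x; x1; x2; y1] `|` names f1 `|` A).
  have yf2 : y2 \notin names f1 by move: hy2; eqlia.
  have b2 z := bn_swap x2 z yf2.
  have s3 : same R (Con x y1 x2 f1) (Con x y1 y2 (swap x2 y2 f1)).
    by apply: same_con_swap2 => //; move: hy2; eqlia.
  set f2 := swap x2 y2 f1 in b2 s3; have [_ l3 _ _] := s3.
  have bb : barendregt f2.
    by rewrite /f2 /f1 /swap !barendregt_ren //; apply: swap_inj.
  have s4 := same_trans (same_trans s1 s2) s3.
  have hb z : inb z (bn f2) = inb z (bn f0).
    rewrite b2 !b1; move: yf yf2; setnorm; rewrite b1.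
    move: (inb_disj z d0) (inb_disj x1 d0) (inb_disj x2 d0).
    by eqlia.
  have n1 : ~~ inb y1 (bn f0) by move: yf; setnorm; boolcases.
  have n2 : ~~ inb y2 (bn f0).
    by move: yf2 hy2; setnorm; rewrite b1; eqcases; boolcases.
  (* An idle contraction has a third name to freshen, the contracted one. *)
  have [y3 hy3] := fresh_name ([fset x; x1; x2; y1; y2] `|` names f2 `|` A).
  have [i|ni] := boolP (idle y1 y2 f2).
  + exists (Con y3 y1 y2 f2); split.
    * apply: same_trans s4 _; apply: same_con_idle => //.
      by move: hy3; eqlia.
    * apply: fset_disjI => z; rewrite bn_con i hb.
      by move: (inb_disj z d0) hy1 hy2 hy3; eqlia.
    * rewrite /= bb i /= !inbE !hb.
      by rewrite n1 n2; move: hy3; setnorm; rewrite hb; eqcases; boolcases.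
  + exists (Con x y1 y2 f2); split=> //.
    * apply: fset_disjI => z; rewrite bn_con (negPf ni) hb.
      by move: (inb_disj z d0) hy1 hy2; eqlia.
    * rewrite /= bb (negPf ni) /= !inbE !hb.
      by rewrite n1 n2.
- have [w lf xf] := lterm_wk lM.
  by have [f0 [s0 d0 b0]] := IH lf A; exists (Wk x f0); split=> //; apply: same_wk.
Qed.

(** * Properties of substitution *)

Lemma enum_of_fset0 : enum_fset (fset0 : {fset nat}) = [::].
Proof.
by apply/perm_nilP; apply: uniq_perm => // z; have := inb_fset0 z.
Qed.

Lemma enum_of_fset1 (y : nat) : enum_fset [fset y] = [:: y].
Proof.
apply: perm_small_eq => //; apply: uniq_perm; rewrite ?fset_uniq // => z.
by rewrite mem_seq1; exact: inb_fset1.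
Qed.

Lemma mwk1 (y : nat) (A : {fset nat}) P :
  mwk ([fset y] `\` A) P = if inb y A then P else Wk y P.
Proof.
case: (boolP (inb y A)) => yA.
  have -> : [fset y] `\` A = fset0.
    by apply: fset_eqI => z; rewrite !inN; case: (z =P y) => [->|]; rewrite ?yA ?andbF.
  by rewrite enum_of_fset0.
have -> : [fset y] `\` A = [fset y].
  by apply: fset_eqI => z; rewrite !inN; case: (z =P y) => [->|]; rewrite ?yA ?andbF.
by rewrite enum_of_fset1.
Qed.

Lemma mwk_spec (R : pred resource) (X : seq nat) M :
  R rw -> lterm R M -> uniq X -> (forall y, y \in X -> ~~ inb y (fv M)) ->
  [/\ lterm R (mwk X M),
      forall z : nat, inb z (fv (mwk X M)) = (z \in X) || inb z (fv M)
    & forall rho, erase rho (mwk X M) = erase rho M].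
Proof.
move=> w lM; elim: X => [|y X IH] //= /andP[yX uX] XM.
have [|l f e] := IH uX; first by move=> z zX; apply: XM; rewrite inE zX orbT.
split=> //.
- constructor => //; rewrite inbE f (negPf yX) /=; apply: XM; exact: mem_head.
- by move=> z; rewrite -/(fv _) inb_fset1U f in_cons orbA.
Qed.

(** * Simultaneous contraction of two copies of a list of variables *)

Definition copies (X : seq nat) (r1 r2 : nat -> nat) : Prop :=
  [/\ {in X &, injective r1}, {in X &, injective r2},
      forall y z, y \in X -> z \in X -> r1 y != r2 z
    & forall y, y \in X -> (r1 y \notin X) && (r2 y \notin X)].

Definition mcopy (X : seq nat) (r1 r2 : nat -> nat) : pterm -> pterm :=
  mcon X [seq r1 y | y <- X] [seq r2 y | y <- X].

Lemma copies_cons y X r1 r2 : uniq (y :: X) -> copies (y :: X) r1 r2 ->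
  [/\ copies X r1 r2, y \notin X,
      [/\ r1 y \notin [seq r1 z | z <- X], r1 y \notin [seq r2 z | z <- X],
          r2 y \notin [seq r1 z | z <- X] & r2 y \notin [seq r2 z | z <- X]],
      [/\ y \notin [seq r1 z | z <- X] & y \notin [seq r2 z | z <- X]]
    & [/\ r1 y \notin y :: X, r2 y \notin y :: X & r1 y != r2 y]].
Proof.
move=> /= /andP[yX uX] [i1 i2 d f].
have s z : z \in X -> z \in y :: X by rewrite inE => ->; rewrite orbT.
have yy : y \in y :: X by exact: mem_head.
split=> //.
- split; [by move=> ? ? /s ? /s ?; apply: i1 | by move=> ? ? /s ? /s ?; apply: i2
         | by move=> ? ? /s ? /s ?; apply: d |].
  by move=> z /s /f; rewrite !inE !negb_or => /andP[/andP[_ ->] /andP[_ ->]].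
- split; apply/mapP => -[z zX e].
  + by move: yX; rewrite (i1 _ _ yy (s _ zX) e) zX.
  + by have := d y z yy (s _ zX); rewrite e eqxx.
  + by have := d z y (s _ zX) yy; rewrite e eqxx.
  + by move: yX; rewrite (i2 _ _ yy (s _ zX) e) zX.
- by split; apply/mapP => -[z zX e]; have := f z (s _ zX); rewrite -e !inE eqxx ?andbF.
- by have /andP[h1 h2] := f y yy; split=> //; apply: d.
Qed.

Lemma fv_mcopy X r1 r2 M (z : nat) : uniq X -> copies X r1 r2 ->
  inb z (fv (mcopy X r1 r2 M)) =
  (z \in X) && (inb (r1 z) (fv M) || inb (r2 z) (fv M)) ||
  [&& inb z (fv M), z \notin [seq r1 y | y <- X] & z \notin [seq r2 y | y <- X]].
Proof.
elim: X z => [|y X IH] z; first by rewrite /= andbT.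
move=> u c; have [c' yX [h1 h2 h3 h4] [h5 h6] [h7 h8 h9]] := copies_cons u c.
have uX : uniq X by case/andP: u.
rewrite /mcopy /= fv_con -/(mcopy _ _ _ _) /idle !inbE !IH //.
move: h7 h8; rewrite !in_cons !negb_or => /andP[h7 h7'] /andP[h8 h8'].
rewrite (negPf h7') (negPf h8') h1 h2 h3 h4 /= !andbT.
case: (z =P y) => [->|zy] /=.
  by rewrite (negPf yX) h5 h6 !andbT /= eq_sym (negPf h7) eq_sym (negPf h8) /= !andbT;
    boolcases.
case: (boolP (z \in X)) => [zX|zX] /=; last by rewrite andbC -!andbA; do ! bool_congr.
have -> : z != r1 y by apply: contraNneq h7' => <-.
have -> : z != r2 y by apply: contraNneq h8' => <-.
by rewrite !andbT.
Qed.

Lemma lterm_mcopy (R : pred resource) X r1 r2 M :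
  R rc -> lterm R M -> uniq X -> copies X r1 r2 ->
  (forall y, y \in X -> ~~ inb y (fv M)) ->
  (R rw -> forall y, y \in X -> inb (r1 y) (fv M) && inb (r2 y) (fv M)) ->
  lterm R (mcopy X r1 r2 M).
Proof.
move=> c lM; elim: X => // y X IH u cc XM wM.
have [c' yX [h1 h2 h3 h4] [h5 h6] [h7 h8 h9]] := copies_cons u cc.
have uX : uniq X by case/andP: u.
have s z : z \in X -> z \in y :: X by rewrite inE => ->; rewrite orbT.
rewrite /mcopy /=; constructor => //; rewrite -/(mcopy _ _ _ _).
- by apply: IH => // [z /s|w z /s]; [apply: XM | apply: wM].
- by rewrite inbE inb_fsetD fv_mcopy // (negPf yX) (negPf (XM _ (mem_head _ _))) andbF.
- move=> w; rewrite !inbE !fv_mcopy // h1 h2 h3 h4 !andbT.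
  by have /andP[-> ->] := wM w _ (mem_head _ _); rewrite !orbT.
Qed.

(** The copies lie outside [X], so the outer contractions do not disturb the values that the inner
    ones duplicate. *)
Lemma erase_mcopy X r1 r2 M rho : uniq X -> copies X r1 r2 ->
  exists rho', [/\ erase rho (mcopy X r1 r2 M) = erase rho' M,
     forall y, y \in X -> rho' (r1 y) = rho y,
     forall y, y \in X -> rho' (r2 y) = rho y
   & forall z, z \notin [seq r1 y | y <- X] -> z \notin [seq r2 y | y <- X] ->
     rho' z = rho z].
Proof.
elim: X rho => [|y X IH] rho; first by exists rho.
move=> u cc.
have [c' yX [h1 h2 h3 h4] [h5 h6] [h7 h8 h9]] := copies_cons u cc.
have uX : uniq X by case/andP: u.
rewrite /mcopy /= -/(mcopy _ _ _ _).
have [rho' [e f1 f2 f3]] := IH (upd (upd rho (r1 y) (rho y)) (r2 y) (rho y)) uX c'.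
have g z : z \in X -> upd (upd rho (r1 y) (rho y)) (r2 y) (rho y) z = rho z.
  move=> zX; rewrite /upd; case: eqP => [e'|_]; first by rewrite -e' in_cons zX orbT in h8.
  by case: eqP => [e'|_] //; rewrite -e' in_cons zX orbT in h7.
exists rho'; split=> //.
- move=> z; rewrite inE => /orP[/eqP->|zX]; last by rewrite f1 ?g.
  by rewrite f3 // /upd eqxx; case: ifP.
- move=> z; rewrite inE => /orP[/eqP->|zX]; last by rewrite f2 ?g.
  by rewrite f3 // /upd eqxx.
- move=> z; rewrite !in_cons !negb_or => /andP[z1 zX1] /andP[z2 zX2].
  by rewrite f3 // /upd (negPf z1) (negPf z2).
Qed.

(** Names of [N] that are not free are fixed, and the new names avoid all names of [N]; hence [r] is
    injective on [names N] and agrees there with a globally injective renaming. *)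
Lemma fresh_ren_spec (R : pred resource) N (A : {fset nat}) r :
  fresh_ren (fv N) (A `|` names N) r -> lterm R N ->
  [/\ lterm R (ren r N),
      forall z : nat, inb z (fv (ren r N)) = (z \in [seq r y | y <- fv N]),
      forall z : nat, inb z (names (ren r N)) ==>
        (z \in [seq r y | y <- fv N]) || inb z (names N),
      [disjoint bn N & fv N] -> bn (ren r N) = bn N
    & forall rho, erase rho (ren r N) = erase (rho \o r) N].
Proof.
move=> [ri rA rid] lN.
have rinj : {in names N &, injective r}.
  move=> y z yN zN e.
  case: (boolP (y \in fv N)) => yf; case: (boolP (z \in fv N)) => zf; first exact: ri.
  - by move: (rA _ yf); rewrite e (rid _ zf) inbE inN (_ : inb z (names N)) ?orbT.
  - by move: (rA _ zf); rewrite -e (rid _ yf) inbE inN (_ : inb y (names N)) ?orbT.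
  - by rewrite -(rid _ yf) -(rid _ zf).
have [r' r'inj rr'] := injective_extension rinj.
have eN : ren r N = ren r' N by apply: eq_ren.
have sub z : z \in fv N -> r' z = r z.
  by move=> h; rewrite rr' // inbE namesE /inb h.
rewrite eN; split.
- exact: lterm_ren.
- move=> z; rewrite fv_renP //; apply/imfsetP/mapP => -[y /= yN ->];
  by exists y => //; rewrite sub.
- move=> z; apply/implyP; rewrite /inb names_ren => /imfsetP[y /= yN ->].
  case: (boolP (y \in fv N)) => yf; first by rewrite sub // map_f.
  by rewrite -rr' // rid // /inb yN orbT.
- move=> d; apply/fsetP => z; rewrite bn_renP //.
  have h y : y \in bn N -> r' y = y.
    move=> yN; rewrite -rr'; last by rewrite inbE namesE /inb yN orbT.
    by apply: rid; move/fdisjointP: d; apply.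
  apply/imfsetP/idP => [[y /= yN ->]|zN]; first by rewrite h.
  by exists z => //=; rewrite h.
- move=> rho; rewrite erase_ren //; apply: eq_erase => z zN /=.
  by rewrite sub.
Qed.

(* If x is not free in M, then the free variables of P may differ from those of M,
   as a weakening by a free variable of N disappears. *)
Lemma subst_spec (R : pred resource) M N x P :
  subst M N x P -> lterm R M -> lterm R N -> (R rc -> [disjoint fv M & fv N]) ->
  [/\ lterm R P,
      forall z : nat, if inb x (fv M)
        then inb z (fv P) (+) ~~ ((z != x) && inb z (fv M) || inb z (fv N))
        else (inb z (fv P) ==> inb z (fv M)) &&
             (inb z (fv M) && ~~ inb z (fv N) ==> inb z (fv P))
    & forall rho, erase rho P = erase (upd rho x (erase rho N)) M].
Proof.
(* In the statement, [a (+) ~~ b] is equality of Booleans in a form that case analysis reduces. *)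
elim=> {M N x P}.
- move=> x N _ lN _; split=> //.
  + by move=> z; rewrite !fv_var eqxx andNb /= addbN addbb.
  + by move=> rho /=; rewrite /upd eqxx.
- move=> x y N yx _ lN _; split=> //; first by constructor.
  + by move=> z; rewrite !fv_var eq_sym (negPf yx); case: eqP => //=; boolcases.
  + by move=> rho /=; rewrite /upd (negPf yx).
- move=> x y M N P yx yN _ IH /lterm_lam[lM wM] lN d.
  have [|lP fP eP] := IH lM lN.
    by move=> /d {}d; apply: fset_disjI => z; move: yN (inb_disj z d); eqlia.
  split.
  + by constructor => // /wM; move: (fP y) yN yx; setnorm; eqcases; boolcases.
  + by move=> z; rewrite !fv_lam; move: (fP z) yN yx; setnorm; eqcases; boolcases.
  + move=> rho /=; rewrite eP; congr tlam; apply: eq_erase => z _.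
    have -> : erase (upd (shift \o rho) y (tvar 0)) N = shift (erase rho N).
      rewrite shift_erase; apply: eq_erase => u uN; rewrite /upd.
      by case: eqP => // e; rewrite -e uN in yN.
    rewrite /upd /=; case: (z =P y) => [->|_]; first by rewrite (negPf yx).
    by case: eqP.
- move=> x M1 M2 N P1 P2 _ IH1 _ IH2 /lterm_app[l1 l2 d12] lN d.
  have [|lP1 fP1 eP1] := IH1 l1 lN.
    by move=> /d {}d; apply: fset_disjI => z; move: (inb_disj z d); setnorm; boolcases.
  have [|lP2 fP2 eP2] := IH2 l2 lN.
    by move=> /d {}d; apply: fset_disjI => z; move: (inb_disj z d); setnorm; boolcases.
  split.
  + constructor => // c; apply: fset_disjI => z.
    move: (fP1 z) (fP2 z) (inb_disj z (d c)) (inb_disj z (d12 c)) (inb_disj x (d12 c)).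
    by rewrite fv_app; eqcases; boolcases.
  + by move=> z; move: (fP1 z) (fP2 z); rewrite !fv_app; eqcases; boolcases.
  + by move=> rho /=; rewrite eP1 eP2.
- move=> x y M N P yx _ IH /lterm_wk[w lM yM] lN d.
  have [|lP fP eP] := IH lM lN.
    by move=> /d {}d; apply: fset_disjI => z; move: (inb_disj z d); setnorm; boolcases.
  rewrite mwk1; case: (boolP (inb y (fv N))) => yN; split => //.
  + by move=> z; rewrite !fv_wk; move: (fP z) yN yx; setnorm; eqcases; boolcases.
  + by constructor => //; move: (fP y) yN yM; setnorm; eqcases; boolcases.
  + by move=> z; rewrite !fv_wk; move: (fP z) yN yx; setnorm; eqcases; boolcases.
- move=> x M N /lterm_wk[w lM xM] lN d.
  have [|lP fP eP] := mwk_spec w lM (fset_uniq (fv N `\` fv M)).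
    by move=> y; rewrite inbE inb_fsetD => /andP[].
  split => //.
  + move=> z; rewrite fP inbE inb_fsetD !fv_wk eqxx /=.
    by move: xM; setnorm; eqcases; boolcases.
  + move=> rho /=; rewrite eP; apply: eq_erase => z zM; rewrite /upd.
    by case: eqP => // e; rewrite -e zM in xM.
- move=> x y y1 y2 M N P yx y1x y2x yN y1N y2N _ IH /lterm_con[c lM [ne yM wM]] lN d.
  have [|lP fP eP] := IH lM lN.
    by move=> /d {}d; apply: fset_disjI => z; move: (inb_disj z d) y1N y2N yN; eqlia.
  (* [y1] and [y2] differ from [x] and are not free in [N], so the substitution neither creates nor
     removes them. *)
  have iP : idle y1 y2 P = idle y1 y2 M.
    move: (fP y1) (fP y2) y1N y2N; rewrite y1x y2x /idle; setnorm; boolcases.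
  split.
  + constructor => //.
    * by move: (fP y) yN yM; setnorm; eqcases; boolcases.
    * by move=> /wM; move: (fP y1) (fP y2) y1N y2N; rewrite y1x y2x; setnorm; boolcases.
  + move=> z; rewrite !fv_con iP; move: (fP z) y1N y2N yN yx y1x y2x.
    by setnorm; eqcases; boolcases.
  + move=> rho /=; rewrite eP; apply: eq_erase => z _; rewrite /upd.
    have -> : erase (upd (upd rho y1 (rho y)) y2 (rho y)) N = erase rho N.
      apply: eq_erase => u uN; rewrite /upd; case: eqP => [e|_].
        by rewrite -e uN in y2N.
      by case: eqP => // e; rewrite -e uN in y1N.
    rewrite (negPf yx); case: (z =P y2) => [->|_]; first by rewrite (negPf y2x).
    by case: (z =P y1) => [->|_]; first by rewrite (negPf y1x).
- move=> x x1 x2 M N r1 r2 P1 P2 x1x x2x fr1 fr2 r12 _ IH1 _ IH2.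
  move=> /lterm_con[c lM [ne xM wM]] lN d.
  have [lN1 fN1 _ _ eN1] := fresh_ren_spec fr1 lN.
  have [lN2 fN2 _ _ eN2] := fresh_ren_spec fr2 lN.
  have [i1 a1 _] := fr1; have [i2 a2 _] := fr2.
  have nr r (z : nat) :
      fresh_ren (fv N) ([fset x; x1; x2] `|` names M `|` names N) r ->
      z \in [seq r y | y <- fv N] ->
      [&& z != x, z != x1, z != x2, ~~ inb z (fv M) & ~~ inb z (fv N)].
    by move=> [_ h _] /mapP[y /h + ->]; setlia.
  have cp : copies (fv N) r1 r2.
    split=> // y yN; have := nr r1 (r1 y) fr1 (map_f _ yN).
    have := nr r2 (r2 y) fr2 (map_f _ yN).
    by move=> /and5P[_ _ _ _ h2] /and5P[_ _ _ _ h1]; apply/andP.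
  have n12 (z : nat) : z \in [seq r1 y | y <- fv N] ->
      z \notin [seq r2 y | y <- fv N].
    move=> /mapP[y yN ->]; apply/mapP => -[u uN e].
    by move: (r12 y u yN uN); rewrite e eqxx.
  have [|lP1 fP1 eP1] := IH1 lM lN1.
    move=> _; apply: fset_disjI => z zM; rewrite fN1; apply/negP => /(nr _ _ fr1).
    by rewrite zM /= !andbF.
  have [|lP2 fP2 eP2] := IH2 lP1 lN2.
    move=> _; apply: fset_disjI => z; move: (fP1 z); rewrite fN1 fN2.
    case: (boolP (z \in map r2 _)) => // /[dup] z2 /(nr _ _ fr2) /and5P[_ _ _ h _].
    have := n12 z; rewrite z2; case: (z \in map r1 _) => [/(_ isT)//|_].
    by move: h; boolcases.
  have x2P1 : inb x2 (fv P1) = inb x2 (fv M).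
    have := fP1 x2; rewrite fN1 eq_sym ne /=.
    case: (boolP (x2 \in map r1 _)) => [/(nr _ _ fr1)|_]; first by rewrite eqxx !andbF.
    by boolcases.
  have fP z : inb z (fv P2) =
      [|| (z \in map r1 (fv N)) && inb x1 (fv M),
          (z \in map r2 (fv N)) && inb x2 (fv M)
        | [&& inb z (fv M), z != x1 & z != x2]].
    have := fP1 z; have := fP2 z; rewrite fN1 fN2 x2P1.
    have := n12 z; have := nr _ z fr1; have := nr _ z fr2.
    case: (z \in map r1 _); case: (z \in map r2 _) => h1 h2 h3.
    - by have := h3 isT.
    - case/and5P: (h2 isT) => _ /negPf-> /negPf-> /negPf->; rewrite /= ?orbF; boolcases.
    - case/and5P: (h1 isT) => _ /negPf-> /negPf-> /negPf->; rewrite /= ?orbF; boolcases.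
    - by eqcases; boolcases.
  have xM' : [&& inb x (fv M), x != x1 & x != x2] = false.
    by move: xM; rewrite inbE inb_fsetD inb_fset2; boolcases; do 2! case: (_ == _).
  (* Disjointness of free variables leaves [x1] and [x2] as the only names that may be free both in
     [M] and in [N]. *)
  have NM y : inb y (fv N) -> [&& inb y (fv M), y != x1 & y != x2] = false.
    move=> yN; move: (inb_disj y (d c)); rewrite yN andbT fv_con.
    by rewrite negb_or => /andP[_ /negPf].
  have uN := fset_uniq (fv N); have [_ _ _ cpN] := cp.
  rewrite -/(mcopy _ _ _ _); split.
  + apply: lterm_mcopy => // [y yN|w y yN].
      have /andP[h1 h2] : (y \notin map r1 (fv N)) && (y \notin map r2 (fv N)).
        apply/andP; split; apply/negP.
          by move=> /(nr _ _ fr1); rewrite /inb yN /= !andbF.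
        by move=> /(nr _ _ fr2); rewrite /inb yN /= !andbF.
      by rewrite fP (negPf h1) (negPf h2) /= NM.
    have /andP[h1 h2] := wM w.
    by rewrite !fP !map_f // [inb x1 _]h1 [inb x2 _]h2 /= orbT.
  + move=> z; rewrite fv_mcopy // (fP z).
    have -> : (z \in enum_fset (fv N)) && (inb (r1 z) (fv P2) || inb (r2 z) (fv P2)) =
        inb z (fv N) && ~~ idle x1 x2 M.
      rewrite -[z \in _]/(inb z (fv N)) /idle; case: (boolP (inb z (fv N))) => // zN.
      have z1 := map_f r1 zN; have z2 := map_f r2 zN.
      have n21 : r2 z \notin map r1 (fv N) by apply/negP => /n12; rewrite z2.
      rewrite !fP z1 z2 (negPf (n12 _ z1)) (negPf n21).
      have /and5P[_ _ _ /negPf-> _] := nr _ _ fr1 z1.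
      have /and5P[_ _ _ /negPf-> _] := nr _ _ fr2 z2.
      by to_inb; boolcases.
    have -> : [&& [|| (z \in map r1 (fv N)) && inb x1 (fv M),
          (z \in map r2 (fv N)) && inb x2 (fv M)
        | [&& inb z (fv M), z != x1 & z != x2]], z \notin map r1 (fv N)
        & z \notin map r2 (fv N)] = [&& inb z (fv M), z != x1 & z != x2].
      have := nr _ z fr1; have := nr _ z fr2.
      case: (z \in map r1 _); case: (z \in map r2 _) => h2 h1; rewrite /= ?andbT //.
      * by case/and5P: (h1 isT) => _ _ _ /negPf->; rewrite !andbF.
      * by case/and5P: (h1 isT) => _ _ _ /negPf->; rewrite !andbF.
      * by case/and5P: (h2 isT) => _ _ _ /negPf->; rewrite !andbF.
    rewrite !fv_con eqxx /= xM' orbF; move: (NM z); case: (idle x1 x2 M) => /=.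
      by rewrite andbF /=; case: (_ && _); boolcases.
    move=> h; case: (z =P x) => [->|_] /=; last by rewrite andbT orbC; case: (_ || _).
    by rewrite xM' andbT orbF; case: (inb x (fv N)).
  (* Both copies of [N] erase to the erasure of [N], so the two successive updates give [x1] and
     [x2] the value that the right-hand side gives to [x]. *)
  + move=> rho; have [rho' [-> h1 h2 h3]] := erase_mcopy P2 rho uN cp.
    have er r : (forall y, y \in enum_fset (fv N) -> rho' (r y) = rho y) ->
        erase (rho' \o r) N = erase rho N.
      by move=> h; apply: eq_erase.
    rewrite eP2 eP1 eN2 (er _ h2) /=.
    have -> : erase (upd rho' x2 (erase rho N)) (ren r1 N) = erase rho N.
      rewrite -(er _ h1) -eN1; apply: eq_erase => u; rewrite /upd.
      by rewrite inbE fN1 => /(nr _ _ fr1) /and5P[_ _ /negPf-> _ _].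
    apply: eq_erase => z zM; rewrite /upd eqxx.
    case: (z =P x1) => [->|/eqP zx1]; first by rewrite (negPf ne); case: (_ == x).
    case: (z =P x2) => [//|/eqP zx2].
    have zx : z != x by apply: contraFneq xM' => <-; rewrite zx1 zx2 [inb z _]zM.
    rewrite (negPf zx) h3 //; apply/negP.
      by move=> /(nr _ _ fr1); rewrite /inb zM !andbF.
    by move=> /(nr _ _ fr2); rewrite /inb zM !andbF.
Qed.

(** * Existence of substitutions *)

Definition substs := seq (nat * pterm).

Definition collect (s : nat * pterm -> seq nat) (L : substs) : seq nat :=
  flatten [seq s p | p <- L].

Lemma collect_cat s L L' : collect s (L ++ L') = collect s L ++ collect s L'.
Proof. by rewrite /collect map_cat flatten_cat. Qed.

Lemma collect_cons s p L : collect s (p :: L) = s p ++ collect s L.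
Proof. by []. Qed.

(** Substituted variables stand beside the free variables of the substituted terms: a duplicate-free
    [evs] says that no substitution touches what another one introduces. *)
Definition evs := collect (fun p => p.1 :: fv p.2).
Definition fvs := collect (fun p => fv p.2).
Definition bns := collect (fun p => bn p.2).
Definition nms := collect (fun p => names p.2).

Lemma fvs_evs L z : z \in fvs L -> z \in evs L.
Proof.
elim: L => // p L IH; rewrite /fvs /evs !collect_cons !mem_cat in_cons.
by case/orP => [->|/IH h]; rewrite ?orbT // [z \in collect _ _]h !orbT.
Qed.

(* Clause [sb_con] of [subst] substitutes in the result of a first substitution.
   Existence is therefore proved, by structural induction on the term, for
   successive substitutions.  [F] contains the names that the inner steps must
   not create, so that fresh names chosen beforehand remain fresh. *)
Inductive chain (F : seq nat) : pterm -> substs -> pterm -> Prop :=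
| chain_nil M : chain F M [::] M
| chain_cons M x N L P Q :
    subst M N x P ->
    (forall z, z \in F -> inb z (names P) ==> inb z (names M) || inb z (names N)) ->
    chain F P L Q -> chain F M ((x, N) :: L) Q.

Lemma chain_weaken F F' M L Q : {subset F <= F'} -> chain F' M L Q -> chain F M L Q.
Proof.
move=> s; elim=> {M L Q} [M|M x N L P Q h n _ IH]; first by constructor.
by apply: chain_cons h _ IH => z /s; apply: n.
Qed.

Lemma chain_inv F M x N L Q : chain F M ((x, N) :: L) Q ->
  exists P, [/\ subst M N x P,
    forall z, z \in F -> inb z (names P) ==> inb z (names M) || inb z (names N)
    & chain F P L Q].
Proof. by move=> h; inversion h; exists P. Qed.

Lemma chain_cat F M L L' P Q :
  chain F M L P -> chain F P L' Q -> chain F M (L ++ L') Q.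
Proof. by elim=> {M L P} // M x N L P P' h n _ IH /IH; apply: chain_cons. Qed.

Lemma chain_split F M L L' Q :
  chain F M (L ++ L') Q -> exists2 P, chain F M L P & chain F P L' Q.
Proof.
elim: L M => [|[x N] L IH] M /=; first by exists M => //; constructor.
move=> /chain_inv[P [s n /IH[P' h1 h2]]].
by exists P' => //; apply: chain_cons s n h1.
Qed.

Lemma chain_names F M L Q z : chain F M L Q -> z \in F ->
  inb z (names Q) ==> inb z (names M) || (z \in nms L).
Proof.
move=> h zF; elim: h => {M L Q} [M|M x N L P Q _ n _ IH]; first by rewrite orbF implybb.
move: (n z zF) IH; rewrite /nms collect_cons mem_cat -[z \in enum_fset _]/(inb z (names N)).
by case: (z \in collect _ _); boolcases.
Qed.

Lemma chain_lam F y M L Q :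
  y \notin evs L -> chain F M L Q -> chain F (Lam y M) L (Lam y Q).
Proof.
move=> yL h; elim: h yL => {M L Q} [M|M x N L P Q h n _ IH]; first by constructor.
rewrite /evs collect_cons mem_cat in_cons !negb_or -andbA => /and3P[yx yN yL].
apply: chain_cons (IH yL); first by constructor.
by move=> z /n; setnorm; case: (z == y); boolcases.
Qed.

Lemma chain_app F M M' L Q Q' :
  chain F M L Q -> chain F M' L Q' -> chain F (App M M') L (App Q Q').
Proof.
move=> h; elim: h M' Q' => {M L Q} [M|M x N L P Q h n _ IH] M' Q' h'.
  by inversion h'; subst; constructor.
have [P' [s' n' c']] := chain_inv h'.
apply: chain_cons (IH _ _ c'); first by constructor.
by move=> z zF; move: (n z zF) (n' z zF); setnorm; boolcases.
Qed.

Lemma chain_wk F y M L Q :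
  y \notin evs L -> chain F M L Q -> chain F (Wk y M) L (Wk y Q).
Proof.
move=> yL h; elim: h yL => {M L Q} [M|M x N L P Q h n _ IH]; first by constructor.
rewrite /evs collect_cons mem_cat in_cons !negb_or -andbA => /and3P[yx yN yL].
apply: chain_cons (IH yL); last first.
  by move=> z /n; setnorm; case: (z == y); boolcases.
have := @sb_wk_neq x y M N P yx h; rewrite mwk1.
by rewrite [inb y _](negPf yN).
Qed.

Lemma chain_con F y y1 y2 M L Q :
  y \notin evs L -> y1 \notin evs L -> y2 \notin evs L ->
  chain F M L Q -> chain F (Con y y1 y2 M) L (Con y y1 y2 Q).
Proof.
move=> yL y1L y2L h; elim: h yL y1L y2L => {M L Q} [M|M x N L P Q h n _ IH].
  by constructor.
rewrite /evs !collect_cons !mem_cat !in_cons !negb_or -!andbA.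
move=> /and3P[yx yN yL] /and3P[y1x y1N y1L] /and3P[y2x y2N y2L].
apply: chain_cons (IH yL y1L y2L); first by constructor.
by move=> z /n; rewrite [names (Con _ _ _ P)]/= [names (Con _ _ _ M)]/= !inb_fsetU;
  boolcases.
Qed.

Lemma chain_mwk F X M L Q : (forall y, y \in X -> y \notin evs L) ->
  chain F M L Q -> chain F (mwk X M) L (mwk X Q).
Proof.
elim: X => [|y X IH] //= h c; apply: chain_wk; first by apply: h; apply: mem_head.
by apply: IH c => z zX; apply: h; rewrite inE zX orbT.
Qed.

Lemma chain_mcopy F X r1 r2 M L Q :
  (forall y, y \in X -> [&& y \notin evs L, r1 y \notin evs L & r2 y \notin evs L]) ->
  chain F M L Q -> chain F (mcopy X r1 r2 M) L (mcopy X r1 r2 Q).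
Proof.
elim: X => [|y X IH] //= h c.
have /and3P[h1 h2 h3] := h y (mem_head _ _).
apply: chain_con => //.
by apply: IH c => z zX; apply: h; rewrite inE zX orbT.
Qed.

Lemma subst_id M N x : ~~ inb x (names M) ->
  (forall z, inb z (fv N) -> ~~ inb z (names M)) -> subst M N x M.
Proof.
elim: M => [y|y M IH|M IHM M' IHM'|y y1 y2 M IH|y M IH] /=.
- by move=> h _; constructor; move: h; rewrite inb_fset1 eq_sym.
- rewrite inb_fset1U negb_or => /andP[xy xM] h.
  constructor; first by rewrite eq_sym.
    by apply/negP => /h; rewrite inb_fset1U eqxx.
  by apply: IH => // z /h; rewrite inb_fset1U negb_or => /andP[].
- rewrite inb_fsetU negb_or => /andP[xM xM'] h.
  by constructor; [apply: IHM | apply: IHM'] => // z /h;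
     rewrite inb_fsetU negb_or => /andP[].
- rewrite !inN !negb_or -!andbA => /and5P[xy xy1 xy2 xM xM'] h.
  have h' z : inb z (fv N) -> [&& z != y, z != y1 & z != y2].
    by move/h; rewrite !inN !negb_or -!andbA => /and5P[-> -> ->].
  constructor; rewrite 1?eq_sym //.
  + by apply/negP => /h'; rewrite eqxx.
  + by apply/negP => /h'; rewrite eqxx !andbF.
  + by apply/negP => /h'; rewrite eqxx !andbF.
  + apply: IH; first by rewrite namesE negb_or xM.
    by move=> z /h; rewrite !inN !negb_or -!andbA => /and5P[_ _ _ -> ->].
- rewrite inb_fset1U negb_or => /andP[xy xM] h.
  have yN : inb y (fv N) = false by apply/negP => /h; rewrite inb_fset1U eqxx.
  have := @sb_wk_neq x y M N M; rewrite mwk1 yN; apply; first by rewrite eq_sym.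
  by apply: IH => // z /h; rewrite inb_fset1U negb_or => /andP[].
Qed.

Lemma chain_id F M L : (forall z, z \in evs L -> ~~ inb z (names M)) ->
  chain F M L M.
Proof.
elim: L => [|[x N] L IH] h; first by constructor.
have h' z : [|| z == x, inb z (fv N) | z \in evs L] -> ~~ inb z (names M).
  by move=> hz; apply: h; rewrite /evs collect_cons mem_cat in_cons -orbA.
apply: chain_cons.
- by apply: subst_id => [|z zN]; apply: h'; rewrite ?eqxx ?zN ?orbT.
- by move=> z _; boolcases.
- by apply: IH => z zL; apply: h'; rewrite zL !orbT.
Qed.

Lemma split_substs (x : nat) (L : substs) : x \in unzip1 L ->
  exists L1 N L2, L = L1 ++ (x, N) :: L2.
Proof.
elim: L => // -[y N] L IH; rewrite /= in_cons => /orP[/eqP->|/IH[L1 [P [L2 ->]]]].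
  by exists [::], N, L.
by exists ((y, N) :: L1), P, L2.
Qed.

Lemma uniq_catP (s t : seq nat) :
  uniq (s ++ t) <-> [/\ uniq s, uniq t & forall z, z \in s -> z \notin t].
Proof.
rewrite cat_uniq; split=> [/and3P[us /hasPn h ut]|[us ut h]].
  by split=> // z zs; apply/negP => /h; rewrite zs.
by rewrite us ut andbT /=; apply/hasPn => z zt; apply/negP => /h; rewrite zt.
Qed.

Lemma evs_unzip1 (L : substs) z : z \in evs L -> (z \in unzip1 L) || (z \in fvs L).
Proof.
elim: L => // -[x N] L IH; rewrite /evs /fvs !collect_cons /= in_cons mem_cat !in_cons
  mem_cat.
by case/or3P=> [->|->|/IH/orP[->|h]] //; rewrite ?orbT // [z \in collect _ _]h !orbT.
Qed.

Lemma inb_enum z (A : {fset nat}) : (z \in enum_fset A) = inb z A.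
Proof. by []. Qed.

(** The invariant of [subst_chain]. Under it the substitutions of [L] act independently and capture
    nothing, and it survives the replacement of a pair by two pairs with renamed copies of its
    term. *)
Record var_convention (R : pred resource) (M : pterm) (L : substs) : Prop := VarConvention {
  convention_uniq : uniq (evs L);
  convention_evs_bn : forall z, z \in evs L -> ~~ inb z (bn M);
  convention_evs_bns : forall z, z \in evs L -> z \notin bns L;
  convention_fvs : forall z, z \in fvs L -> ~~ inb z (fv M);
  convention_bns : forall z, z \in bns L -> ~~ inb z (bn M);
  convention_lterm : forall p, List.In p L -> lterm R p.2 }.

(** A free variable of a subterm may be bound further out; the names of [L] avoid those as well. *)
Lemma convention_sub R M M' L : var_convention R M L ->
  (forall z, inb z (bn M') ==> inb z (bn M)) ->
  (forall z, inb z (fv M') ==> inb z (fv M) || inb z (bn M)) -> var_convention R M' L.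
Proof.
case=> u e1 e2 f b l hb hf; split=> // z h.
- by move: (hb z) (e1 z h); boolcases.
- by move: (hf z) (f z h) (e1 z (fvs_evs h)); boolcases.
- by move: (hb z) (b z h); boolcases.
Qed.

Lemma convention_rem R M L1 p L2 : var_convention R M (L1 ++ p :: L2) ->
  var_convention R M (L1 ++ L2).
Proof.
case=> u e1 e2 f b l.
have s g z : z \in collect g (L1 ++ L2) -> z \in collect g (L1 ++ p :: L2).
  by rewrite !collect_cat collect_cons !mem_cat => /orP[->|->]; rewrite ?orbT.
split=> // [|z /s /e1|z /s /e2|z /s /f|z /s /b|q /List.in_app_iff h] //.
- move: u; rewrite /evs !collect_cat collect_cons.
  move=> /uniq_catP[u1 /uniq_catP[_ u2 _] d]; apply/uniq_catP; split=> // z /d.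
  by rewrite mem_cat negb_or => /andP[].
- by apply: contra => /s.
- by apply: l; apply/List.in_app_iff; case: h => /=; auto.
Qed.

Lemma fresh_pair (X S : seq nat) : exists r1 r2 : nat -> nat,
  [/\ {in X &, injective r1} /\ {in X &, injective r2},
      forall y, y \in X -> (r1 y \notin S) && (r2 y \notin S),
      forall y z, y \in X -> z \in X -> r1 y != r2 z
    & forall y, y \notin X -> r1 y = y /\ r2 y = y].
Proof.
have [m hm] := fresh_nat (X ++ S).
(* [m] exceeds all names in [X] and [S], so the copies lie in the disjoint ranges from m to 2m and
   from 2m to 3m. *)
pose r k y := if y \in X then (y + k * m)%N else y.
have rX k y : y \in X -> r k y = (y + k * m)%N by rewrite /r => ->.
have inj k : {in X &, injective (r k)} by move=> y z yX zX; rewrite !rX //; lia.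
have ltX y : y \in X -> y < m by move=> yX; apply: hm; rewrite mem_cat yX.
have rS k y : 0 < k -> y \in X -> r k y \notin S.
  move=> k0 yX; apply/negP => yS; have : r k y < m by apply: hm; rewrite mem_cat yS orbT.
  by rewrite rX //; nia.
exists (r 1), (r 2); split=> //.
- by move=> y yX; rewrite !rS.
- move=> y z yX zX; rewrite !rX //; have := ltX y yX; clear; lia.
- by move=> y /negPf yX; rewrite /r yX.
Qed.

Lemma names_mcopy X r1 r2 M z : inb z (names (mcopy X r1 r2 M)) ->
  [|| z \in X, z \in map r1 X, z \in map r2 X | inb z (names M)].
Proof.
elim: X => [|y X IH] //=; rewrite !inb_set => /orP[|/IH].
  by rewrite !in_cons -orbA => /or3P[->|->|->]; rewrite ?orbT.
by rewrite !in_cons => /or4P[->|->|->|->]; rewrite ?orbT.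
Qed.

Lemma names_mwk X M z : inb z (names (mwk X M)) = (z \in X) || inb z (names M).
Proof. by elim: X => [|y X IH] //=; rewrite inb_fset1U IH in_cons orbA. Qed.

(** Induction on the term, for all lists. At a contraction of a substituted [x], the pair of [x] and
    [N] gives way to pairs of [x1] and [x2] with copies of [N]: the list grows while the term
    shrinks. *)
Lemma subst_chain (R : pred resource) M L F : R rc -> lterm R M -> barendregt M ->
  var_convention R M L -> exists Q, chain F M L Q.
Proof.
move=> c lM; elim: lM L F => {M}.
- move=> y L F _ cv; case: (boolP (y \in unzip1 L)) => yL.
    have [L1 [N [L2 eL]]] := split_substs yL; subst L; case: cv => u e1 e2 f b l.
    exists N; move: u; rewrite /evs collect_cat collect_cons /=.
    move=> /uniq_catP[u1 u2 d1]; have [_ _ d2] :=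
      (uniq_catP (y :: fv N) (collect _ L2)).1 u2.
    (* The pairs before that of [y] do not act on [y], and those after it do not act on [N]. *)
    apply: (@chain_cat _ _ _ _ (Var y)).
      apply: chain_id => z /d1; rewrite /= in_cons negb_or => /andP[h _].
      by rewrite inb_fset1.
    apply: chain_cons; first by constructor.
      by move=> z _; boolcases.
    apply: chain_id => z zL; rewrite namesE negb_or; apply/andP; split; apply/negP => zN.
      by have := d2 z; rewrite in_cons zL inb_enum zN orbT => /(_ isT).
    have := e2 z; rewrite /evs /bns !collect_cat !collect_cons !mem_cat [z \in collect
      _ L2]zL !orbT.
    by rewrite inb_enum zN orbT => /(_ isT).
  exists (Var y); apply: chain_id => z /[dup] zL /evs_unzip1.
  rewrite /= inb_fset1 => /orP[h|h]; first by apply: contraNneq yL => <-.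
  by have := convention_fvs cv h; rewrite fv_var.
- move=> y M lM IH wM L F /andP[yM bM] cv.
  have [|Q h] := IH L F bM.
    by apply: convention_sub cv _ _ => z; setnorm; case: (z == y); boolcases.
  exists (Lam y Q); apply: chain_lam h; apply/negP => /(convention_evs_bn cv).
  by rewrite bn_lam eqxx.
- move=> M M' lM IH lM' IH' _ L F /and3P[_ bM bM'] cv.
  have [|Q h] := IH L F bM.
    by apply: convention_sub cv _ _ => z; setnorm; boolcases.
  have [|Q' h'] := IH' L F bM'.
    by apply: convention_sub cv _ _ => z; setnorm; boolcases.
  by exists (App Q Q'); apply: chain_app.
- move=> y M w lM IH yM L F bM cv.
  have cv' : var_convention R M L.
    by apply: convention_sub cv _ _ => z; setnorm; case: (z == y); boolcases.
  case: (boolP (y \in unzip1 L)) => yL; last first.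
    have [Q h] := IH L F bM cv'.
    exists (Wk y Q); apply: chain_wk h; apply: contra yL => /evs_unzip1 /orP[//|].
    by move=> /(convention_fvs cv); rewrite fv_wk eqxx.
  have [L1 [N [L2 eL]]] := split_substs yL; subst L.
  (* The pair of [y] only replaces the weakening by weakenings over [N]; the body undergoes the
     other substitutions. *)
  have [Q /chain_split[P h1 h2]] := IH _ F bM (convention_rem cv').
  exists (mwk (fv N `\` fv P) Q).
  have := convention_uniq cv; rewrite /evs collect_cat collect_cons /=.
  move=> /uniq_catP[u1 u2 d1]; have [_ _ d2] := (uniq_catP (y :: fv N) (collect _ L2)).1 u2.
  apply: (@chain_cat _ _ _ _ (Wk y P)).
    by apply: chain_wk h1; apply/negP => /d1; rewrite mem_head.
  apply: chain_cons; first by constructor.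
    move=> z _; rewrite names_mwk inb_enum inb_fsetD /= inb_fset1U (namesE N).
    by boolcases.
  apply: chain_mwk h2 => z; rewrite inb_enum inb_fsetD => /andP[_ zN].
  by apply: d2; rewrite in_cons inb_enum zN orbT.
- move=> x x1 x2 M _ lM IH ne xM wM L F /and4P[x1M x2M xi bM] cv.
  have x1bn : inb x1 (bn (Con x x1 x2 M)) by rewrite bn_con eqxx.
  have x2bn : inb x2 (bn (Con x x1 x2 M)) by rewrite bn_con eqxx orbT.
  have bnM z : inb z (bn M) ==> inb z (bn (Con x x1 x2 M)).
    by rewrite bn_con; boolcases.
  have fvM z : inb z (fv M) ==> inb z (fv (Con x x1 x2 M)) || inb z (bn (Con x x1 x2 M)).
    by rewrite bn_con fv_con; case: (z == x1); case: (z == x2); boolcases.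
  have x1L : x1 \notin evs L by apply/negP => /(convention_evs_bn cv); rewrite x1bn.
  have x2L : x2 \notin evs L by apply/negP => /(convention_evs_bn cv); rewrite x2bn.
  case: (boolP (x \in unzip1 L)) => xL; last first.
    have [Q h] := IH L F bM (convention_sub cv bnM fvM).
    exists (Con x x1 x2 Q); apply: chain_con h => //; apply/negP => /[dup] h /evs_unzip1.
    rewrite (negPf xL) => /(convention_fvs cv); have := convention_evs_bn cv h.
    by rewrite fv_con bn_con eqxx /=; case: idle; rewrite /= ?orbT.
  have [L1 [N [L2 eL]]] := split_substs xL; subst L => {xL}.
  have evE z : z \in evs (L1 ++ (x, N) :: L2) =
    [|| z \in evs L1, z == x, inb z (fv N) | z \in evs L2].
    by rewrite /evs collect_cat collect_cons !mem_cat /= in_cons -orbA.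
  have bnE z : z \in bns (L1 ++ (x, N) :: L2) =
    [|| z \in bns L1, inb z (bn N) | z \in bns L2].
    by rewrite /bns collect_cat collect_cons !mem_cat.
  have fvE z : z \in fvs (L1 ++ (x, N) :: L2) =
    [|| z \in fvs L1, inb z (fv N) | z \in fvs L2].
    by rewrite /fvs collect_cat collect_cons !mem_cat.
  have lN : lterm R N by apply: (convention_lterm cv (p := (x, N)));
    apply/List.in_app_iff; right; left.
  have dN : [disjoint bn N & fv N].
    apply: fset_disjI => z zb; apply/negP => zf.
    by have := convention_evs_bns cv (z := z); rewrite evE bnE zf zb !orbT => /(_ isT).
  pose S := F ++ names M ++ names N ++ [:: x; x1; x2] ++ evs (L1 ++ (x, N) :: L2) ++
    bns (L1 ++ (x, N) :: L2) ++ nms L1.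
  have [r1 [r2 [[i1 i2] rS r12 rid]]] := fresh_pair (fv N) S.
  have SE z : z \notin S -> [&& z \notin F, ~~ inb z (names M), ~~ inb z (names N),
      [&& z != x, z != x1 & z != x2], z \notin evs (L1 ++ (x, N) :: L2),
      z \notin bns (L1 ++ (x, N) :: L2) & z \notin nms L1].
    by rewrite /S !mem_cat !in_cons in_nil !inb_enum orbF !negb_or -!andbA.
  pose X12 := map r1 (fv N) ++ map r2 (fv N).
  have XS z : z \in X12 -> z \notin S.
    rewrite mem_cat => /orP[] /mapP[y yN ->]; by case/andP: (rS y yN).
  have frA r (A : {fset nat}) : r = r1 \/ r = r2 ->
      (forall z, z \in X12 -> ~~ inb z A) ->
      fresh_ren (fv N) ([fset x; x1; x2] `|` A `|` names N) r.
    move=> hr h; split.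
    - by case: hr => ->.
    - move=> y yN; have yX : r y \in X12.
        by rewrite mem_cat; case: hr => ->; rewrite map_f ?orbT.
      have := SE _ (XS _ yX); case/and5P=> _ _ yN' y3 _.
      rewrite inbE !inb_set !negb_or -!andbA yN' andbT.
      by case/and3P: y3 => -> -> ->; rewrite h.
    - by move=> y /rid[]; case: hr => ->.
  have nM z : z \in X12 -> ~~ inb z (names M) by move=> /XS/SE/and5P[].
  have fr1 := frA r1 _ (or_introl erefl) nM.
  have fr2 := frA r2 _ (or_intror erefl) nM.
  have [lN1 fN1 nN1 bN1 _] := fresh_ren_spec fr1 lN.
  have [lN2 fN2 nN2 bN2 _] := fresh_ren_spec fr2 lN.
  (* The names of the copies are fixed before [L1] acts, yet must be fresh for its result; listed in
     [F'], they are kept out of that result by the induction hypothesis. *)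
  pose F' := X12 ++ F.
  pose L' := L1 ++ (x1, ren r1 N) :: (x2, ren r2 N) :: L2.
  have N1X z : inb z (fv (ren r1 N)) -> z \in X12 by rewrite fN1 mem_cat => ->.
  have N2X z : inb z (fv (ren r2 N)) -> z \in X12 by rewrite fN2 mem_cat orbC => ->.
  have XE z : z \in X12 -> [/\ z \notin F, ~~ inb z (names M),
      [/\ z != x, z != x1 & z != x2], [/\ z \notin evs (L1 ++ (x, N) :: L2),
      z \notin evs L1 & z \notin evs L2] &
      z \notin bns (L1 ++ (x, N) :: L2) /\ z \notin nms L1].
    move=> /XS/SE/and5P[-> -> _ /and3P[-> -> ->] /and3P[h -> ->]]; rewrite h.
    by move: h; rewrite evE !negb_or => /and4P[-> _ _ ->].
  have [u1 u2 d1] : [/\ uniq (evs L1), uniq ((x :: fv N) ++ evs L2) &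
      forall z, z \in evs L1 -> z \notin (x :: fv N) ++ evs L2].
    by apply/uniq_catP; have := convention_uniq cv; rewrite /evs collect_cat.
  have [u3 u4 d2] := (uniq_catP _ _).1 u2.
  have cv' : var_convention R M L'.
    have bnL z : z \in bns L' -> z \in bns (L1 ++ (x, N) :: L2).
      rewrite bnE /L' /bns collect_cat !collect_cons !mem_cat /= !inb_enum.
      rewrite (bN1 dN) (bN2 dN) => /or4P[->|->|->|->]; by rewrite ?orbT.
    have evL z : z \in evs L' -> [|| z \in evs L1, z == x1, z == x2, z \in X12 | z \in
      evs L2].
      rewrite /L' /evs collect_cat !collect_cons !mem_cat /= !in_cons !inb_enum -!orbA.
      case/or4P=> [->|->|/N1X h|/or3P[->|/N2X h|->]]; rewrite ?orbT //;
        by move: h; rewrite mem_cat => /orP[->|->]; rewrite ?orbT.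
    move: (x1L) (x2L); rewrite !evE !negb_or => /and4P[x1L1 _ _ x1L2].
    move=> /and4P[x2L1 _ _ x2L2].
    split.
    - rewrite /L' /evs collect_cat !collect_cons.
      have nx y z : z \in X12 -> y \in [:: x1; x2] -> (z == y) = false.
        by move=> /XE[_ _ [_ /negPf zx1 /negPf zx2] _ _]; rewrite !inE => /orP[] /eqP->.
      have uN1 : uniq (x1 :: fv (ren r1 N)).
        rewrite /= fset_uniq andbT; apply/negP => /N1X /nx/(_ (mem_head _ _)).
        by rewrite eqxx.
      have uN2 : uniq (x2 :: fv (ren r2 N)).
        rewrite /= fset_uniq andbT; apply/negP => /N2X /nx/(_ (mem_last _ _)).
        by rewrite eqxx.
      apply/uniq_catP; split=> //.
        apply/uniq_catP; split=> //.
          apply/uniq_catP; split=> // z; rewrite in_cons => /orP[/eqP-> //|/N2X/XE].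
          by case=> _ _ _ [].
        move=> z; rewrite mem_cat !in_cons !inb_enum => /orP[/eqP->|zN1]; rewrite !negb_or.
          rewrite ne; apply/andP; split=> //; apply/negP => /N2X /nx/(_ (mem_head _ _)).
          by rewrite eqxx.
        have zX := N1X _ zN1; have [_ _ [_ _ ->] [_ _ ->] _] := XE _ zX.
        rewrite andbT fN2; apply/mapP => -[y yN e]; move: zN1; rewrite fN1 e.
        by move/mapP => [y' y'N e']; have := r12 _ _ y'N yN; rewrite e' eqxx.
      move=> z zL1; rewrite !mem_cat !in_cons !inb_enum !negb_or -!andbA.
      have zX : z \notin X12 by apply/negP => /XE[_ _ _ [_ h _] _]; rewrite zL1 in h.
      have zN1 : ~~ inb z (fv (ren r1 N)) by apply: contra zX => /N1X.
      have zN2 : ~~ inb z (fv (ren r2 N)) by apply: contra zX => /N2X.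
      rewrite zN1 zN2 /=; have := d1 z zL1; rewrite mem_cat negb_or => /andP[_ ->].
      rewrite andbT; apply/andP; split.
        by apply: contraNneq x1L1 => <-.
      by apply: contraNneq x2L1 => <-.
    - move=> z /evL /or4P[h|/eqP->|/eqP->|/orP[h|h]].
      + by have := convention_evs_bn cv (z := z); rewrite evE h => /(_ isT);
        move: (bnM z); boolcases.
      + by [].
      + by [].
      + by have [_ + _ _ _] := XE _ h; rewrite namesE negb_or => /andP[].
      + by have := convention_evs_bn cv (z := z); rewrite evE h !orbT => /(_ isT);
        move: (bnM z); boolcases.
    - move=> z /evL h; apply/negP => /bnL zb.
      case/or4P: h => [h|/eqP e|/eqP e|/orP[h|h]].
      + by have := convention_evs_bns cv (z := z); rewrite evE h zb => /(_ isT).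
      + by have := convention_bns cv zb; rewrite e x1bn.
      + by have := convention_bns cv zb; rewrite e x2bn.
      + by have [_ _ _ _ []] := XE _ h; rewrite zb.
      + by have := convention_evs_bns cv (z := z); rewrite evE h zb !orbT => /(_ isT).
    - move=> z; rewrite /L' /fvs collect_cat !collect_cons !mem_cat /= !inb_enum.
      have hL : z \in fvs (L1 ++ (x, N) :: L2) -> ~~ inb z (fv M).
        by move=> h; move: (convention_fvs cv h) (convention_evs_bn cv (fvs_evs h))
          (fvM z); boolcases.
      have hX : z \in X12 -> ~~ inb z (fv M).
        by move=> /XE[_ + _ _ _]; rewrite namesE negb_or => /andP[].
      case/or4P=> [h|/N1X //|/N2X //|h]; apply: hL;
        by rewrite fvE; move: h; rewrite /fvs => ->; rewrite ?orbT.
    - by move=> z /bnL /(convention_bns cv); move: (bnM z); boolcases.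
    - move=> p; rewrite /L' => /List.in_app_iff[h|/= [<-|[<-|h]]] //;
        by apply: (convention_lterm cv); apply/List.in_app_iff; rewrite /=; auto.
  have [Q] := IH L' F' bM cv'.
  move=> /chain_split[Ma c1 /chain_inv[Mb [s1 n1 /chain_inv[Mc [s2 n2 c2]]]]].
  exists (mcopy (fv N) r1 r2 Q).
  have FF' : {subset F <= F'} by move=> z zF; rewrite mem_cat zF orbT.
  have nMa z : z \in X12 -> ~~ inb z (names Ma).
    move=> zX; have zF : z \in F' by rewrite mem_cat zX.
    move: (chain_names c1 zF); have [_ /negPf-> _ _ [_ /negPf->]] := XE _ zX.
    by boolcases.
  have d1' z : [|| z == x, z == x1 | z == x2] -> z \notin evs L1.
    move: x1L x2L; rewrite !evE !negb_or => /and4P[h1 _ _ _] /and4P[h2 _ _ _].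
    case/or3P=> /eqP-> //; apply/negP => /d1.
    by rewrite mem_cat mem_head.
  have x1x : x1 != x by apply: contraNneq x1L => ->; rewrite evE eqxx orbT.
  have x2x : x2 != x by apply: contraNneq x2L => ->; rewrite evE eqxx orbT.
  apply: (@chain_cat _ _ _ _ (Con x x1 x2 Ma)).
    by apply: chain_con (chain_weaken FF' c1); apply: d1'; rewrite eqxx ?orbT.
  apply: chain_cons.
  - apply: (sb_con x1x x2x _ _ _ s1 s2).
    + by apply: frA => //; left.
    + by apply: frA => //; right.
    + by move=> y z; apply: r12.
  - move=> z zF; apply/implyP => /names_mcopy.
    have zX : z \notin X12 by apply/negP => /XE[]; rewrite zF.
    have := zX; rewrite mem_cat negb_or => /andP[/negPf-> /negPf->] /=.
    rewrite inb_enum; move: (n2 z (FF' _ zF)) (n1 z (FF' _ zF)) (nN1 z) (nN2 z).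
    rewrite -!fN1 -!fN2; have /negPf-> : ~~ inb z (fv (ren r1 N)).
      by apply: contra zX => /N1X.
    have /negPf-> : ~~ inb z (fv (ren r2 N)) by apply: contra zX => /N2X.
    by rewrite /= inb_fsetU (namesE N); boolcases.
  - apply: chain_mcopy (chain_weaken FF' c2) => y yN.
    have y1 : r1 y \in X12 by rewrite mem_cat map_f.
    have y2 : r2 y \in X12 by rewrite mem_cat map_f ?orbT.
    have [_ _ _ [_ _ ->] _] := XE _ y1; have [_ _ _ [_ _ ->] _] := XE _ y2.
    by rewrite andbT d2 // in_cons yN orbT.
Qed.

(** * Simulation of beta-reduction *)

(** The list invariant asks that no free variable of [N] be free in [M], which is available when
    contraction is explicit. Otherwise no clause in use substitutes twice, and a plain induction
    suffices. *)
Lemma subst_exists (R : pred resource) M N x :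
  lterm R M -> lterm R N -> (R rc -> [disjoint fv M & fv N]) -> barendregt M ->
  ~~ inb x (bn M) -> ~~ inb x (names N) -> [disjoint bn M & names N] ->
  [disjoint bn N & fv N] -> exists P, subst M N x P.
Proof.
move=> lM lN d bM xM xN dMN dN; case: (boolP (R rc)) => c.
  have [|P h] := @subst_chain R M [:: (x, N)] [::] c lM bM.
    have e z : z \in evs [:: (x, N)] = (z == x) || inb z (fv N).
      by rewrite /evs /collect /= cats0 in_cons.
    have b z : z \in bns [:: (x, N)] = inb z (bn N).
      by rewrite /bns /collect /= cats0.
    have f z : z \in fvs [:: (x, N)] = inb z (fv N).
      by rewrite /fvs /collect /= cats0.
    split.
    - rewrite /evs /collect /= cats0 fset_uniq andbT.
      by move: xN; setnorm; rewrite negb_or => /andP[].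
    - move=> z; rewrite e => /orP[/eqP-> //|zN].
      by move: (inb_disj z dMN); rewrite namesE zN andbT.
    - move=> z; rewrite e b => /orP[/eqP->|zN].
        by move: xN; rewrite namesE; boolcases.
      by move: (inb_disj z dN); rewrite zN andbT.
    - by move=> z; rewrite f => zN; move: (inb_disj z (d c)); rewrite zN andbT.
    - by move=> z; rewrite b => zN; move: (inb_disj z dMN); rewrite namesE zN orbT andbT.
    - by move=> p [<-|].
  by have [P' [s _ _]] := chain_inv h; exists P'.
elim: lM xM dMN {d bM} => {M}.
- move=> y _ _; case: (y =P x) => [->|/eqP yx]; first by exists N; constructor.
  by exists (Var y); constructor.
- move=> y M _ IH _ xM dMN.
  have [||P h] := IH.
  + by move: xM; setnorm; boolcases.
  + by apply: fset_disjI => z; move: (inb_disj z dMN); setnorm; boolcases.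
  exists (Lam y P); constructor => //.
  + by apply: contraNneq xM => ->; rewrite bn_lam eqxx.
  + by move: (inb_disj y dMN); setnorm; rewrite eqxx; boolcases.
- move=> M M' _ IH _ IH' _ xM dMN.
  have [||P h] := IH.
  + by move: xM; setnorm; boolcases.
  + by apply: fset_disjI => z; move: (inb_disj z dMN); setnorm; boolcases.
  have [||P' h'] := IH'.
  + by move: xM; setnorm; boolcases.
  + by apply: fset_disjI => z; move: (inb_disj z dMN); setnorm; boolcases.
  by exists (App P P'); constructor.
- move=> y M w _ IH yM xM dMN; case: (y =P x) => [->|/eqP yx].
    by exists (mwk (fv N `\` fv M) M); constructor.
  have [//|//|P h] := IH.
  by exists (mwk ([fset y] `\` fv N) P); constructor.
- by move=> y y1 y2 M c'; rewrite c' in c.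
Qed.

(** The two inclusions serve the formation rules of an enclosing term: the first preserves
    disjointness, the second keeps bound variables free in the body under explicit weakening. *)
Definition lstep (R : pred resource) (M M' : pterm) : Prop :=
  [/\ lterm R M, lterm R M', forall z, inb z (fv M') ==> inb z (fv M),
      R rw -> forall z, inb z (fv M) ==> inb z (fv M')
    & red R M M' \/ eqv R M M'].

Definition reach (R : pred resource) : pterm -> pterm -> Prop :=
  clos_refl_trans _ (lstep R).

Definition plus (R : pred resource) (M M' : pterm) : Prop :=
  exists A B, [/\ reach R M A, lstep R A B /\ red R A B & reach R B M'].

Lemma compat_mono (r r' : pterm -> pterm -> Prop) f g :
  (forall f g, r f g -> r' f g) -> compat r f g -> compat r' f g.
Proof. by move=> h; elim=> *; [apply: cp_base; apply: h | constructor ..]. Qed.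

Lemma crst_mono (r r' : pterm -> pterm -> Prop) f g :
  (forall f g, r f g -> r' f g) ->
  clos_refl_sym_trans _ r f g -> clos_refl_sym_trans _ r' f g.
Proof.
move=> h; elim=> {f g}.
- by move=> f g /h; apply: rst_step.
- by move=> f; apply: rst_refl.
- by move=> f g _; apply: rst_sym.
- by move=> f g k _ fg _; apply: rst_trans fg.
Qed.

Lemma alpha_eqv R f g : alpha f g -> eqv R f g.
Proof. by apply: crst_mono => {f g} f g; apply: compat_mono => {f g} f g; left. Qed.

Lemma same_lstep R f g : same R f g -> lterm R f -> lstep R f g.
Proof.
move=> [a l e _] lf; split=> //; last by right; apply: alpha_eqv.
- by move=> z; rewrite e implybb.
- by move=> _ z; rewrite e implybb.
Qed.

Lemma same_reach R f g : same R f g -> lterm R f -> reach R f g.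
Proof. by move=> s l; apply: rt_step; apply: same_lstep. Qed.

Lemma lstep_ctx R (C : pterm -> pterm) M M' :
  (forall r f g, compat r f g -> compat r (C f) (C g)) -> lstep R M M' ->
  lterm R (C M) ->
  (lterm R M' -> (forall z, inb z (fv M') ==> inb z (fv M)) ->
     (R rw -> forall z, inb z (fv M) ==> inb z (fv M')) ->
     [/\ lterm R (C M'), forall z, inb z (fv (C M')) ==> inb z (fv (C M))
     & R rw -> forall z, inb z (fv (C M)) ==> inb z (fv (C M'))]) ->
  lstep R (C M) (C M').
Proof.
move=> hC [l l' s s' h] lC /(_ l' s s')[lC' t t']; split=> //.
by case: h => [h|h]; [left; apply: hC | right; apply: crst_compat h; apply: hC].
Qed.

Lemma lstep_lam R x M M' : lstep R M M' -> lterm R (Lam x M) ->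
  lstep R (Lam x M) (Lam x M').
Proof.
move=> h lM; apply: (lstep_ctx (C := Lam x) _ h lM) => [*|l' s s']; first by apply: cp_lam.
have [_ xM] := lterm_lam lM; split.
- by constructor => // w; move: (xM w) (s' w x); to_inb; boolcases.
- by move=> z; rewrite !fv_lam; move: (s z); case: (z != x); boolcases.
- by move=> w z; rewrite !fv_lam; move: (s' w z); case: (z != x); boolcases.
Qed.

Lemma lstep_appl R M M' N : lstep R M M' -> lterm R (App M N) ->
  lstep R (App M N) (App M' N).
Proof.
move=> h lM; apply: (lstep_ctx (C := App^~ N) _ h lM) => [*|l' s s'];
  first by apply: cp_appl.
have [_ lN d] := lterm_app lM; split.
- constructor => // c; apply: fset_disjI => z; move: (s z) (inb_disj z (d c)).
  by boolcases.
- by move=> z; rewrite !fv_app; move: (s z); boolcases.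
- by move=> w z; rewrite !fv_app; move: (s' w z); boolcases.
Qed.

Lemma lstep_appr R M N N' : lstep R N N' -> lterm R (App M N) ->
  lstep R (App M N) (App M N').
Proof.
move=> h lM; apply: (lstep_ctx (C := App M) _ h lM) => [*|l' s s']; first by apply: cp_appr.
have [lM' _ d] := lterm_app lM; split.
- constructor => // c; apply: fset_disjI => z; move: (s z) (inb_disj z (d c)).
  by boolcases.
- by move=> z; rewrite !fv_app; move: (s z); boolcases.
- by move=> w z; rewrite !fv_app; move: (s' w z); boolcases.
Qed.

Lemma lstep_wk R x M M' : lstep R M M' -> lterm R (Wk x M) ->
  lstep R (Wk x M) (Wk x M').
Proof.
move=> h lM; apply: (lstep_ctx (C := Wk x) _ h lM) => [*|l' s s']; first by apply: cp_wk.
have [w _ xM] := lterm_wk lM; split.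
- by constructor => //; move: xM (s x); to_inb; boolcases.
- by move=> z; rewrite !fv_wk; move: (s z); case: (z == x); boolcases.
- by move=> _ z; rewrite !fv_wk; move: (s' w z); case: (z == x); boolcases.
Qed.

Lemma lstep_con R x x1 x2 M M' : lstep R M M' -> lterm R (Con x x1 x2 M) ->
  lstep R (Con x x1 x2 M) (Con x x1 x2 M').
Proof.
move=> h lM; apply: (lstep_ctx (C := Con x x1 x2) _ h lM) => [*|l' s s'];
  first by apply: cp_con.
have [c _ [ne xM wM]] := lterm_con lM; split.
- constructor => //; first by move: xM (s x); setnorm; boolcases.
  by move=> w; move: (wM w) (s' w x1) (s' w x2); to_inb; boolcases.
- move=> z; rewrite !fv_con; move: (s z) (s x1) (s x2); rewrite /idle; to_inb.
  by case: (z == x); case: (z == x1); case: (z == x2); boolcases.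
- move=> w z; rewrite !fv_con /idle; move: (s' w z) (wM w) (s' w x1) (s' w x2); to_inb.
  by case: (z == x); case: (z == x1); case: (z == x2); boolcases.
Qed.

Definition context (R : pred resource) (C : pterm -> pterm) : Prop :=
  (forall r f g, compat r f g -> compat r (C f) (C g)) /\
  forall M M', lstep R M M' -> lterm R (C M) -> lstep R (C M) (C M').

Lemma ctx_lam R x : context R (Lam x).
Proof. by split=> [*|M M']; [apply: cp_lam | apply: lstep_lam]. Qed.

Lemma ctx_appl R N : context R (App^~ N).
Proof. by split=> [*|M M']; [apply: cp_appl | apply: lstep_appl]. Qed.

Lemma ctx_appr R N : context R (App N).
Proof. by split=> [*|M M']; [apply: cp_appr | apply: lstep_appr]. Qed.

Lemma ctx_wk R x : context R (Wk x).
Proof. by split=> [*|M M']; [apply: cp_wk | apply: lstep_wk]. Qed.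

Lemma ctx_con R x x1 x2 : context R (Con x x1 x2).
Proof. by split=> [*|M M']; [apply: cp_con | apply: lstep_con]. Qed.

Lemma reach_lterm R M M' : reach R M M' -> lterm R M -> lterm R M'.
Proof. by elim=> {M M'} [M M' []||M M1 M' _ IH _ IH' /IH/IH']. Qed.

Lemma reach_ctx R C M M' : context R C -> reach R M M' -> lterm R (C M) ->
  reach R (C M) (C M').
Proof.
move=> [_ hC]; elim=> {M M'} [M M' h l|M _|M M1 M' _ IH _ IH' l].
- by apply: rt_step; apply: hC.
- exact: rt_refl.
- by have h := IH l; apply: (rt_trans _ _ _ _ _ h (IH' (reach_lterm h l))).
Qed.

Lemma plus_ctx R C M M' : context R C -> plus R M M' -> lterm R (C M) ->
  plus R (C M) (C M').
Proof.
move=> hC [A [B [h1 [h2 h3] h4]]] l; exists (C A), (C B).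
have r1 := reach_ctx hC h1 l; have lA := reach_lterm r1 l.
have oAB := hC.2 _ _ h2 lA; have [_ lB _ _ _] := oAB.
split=> //; first by split=> //; apply: hC.1.
exact: reach_ctx.
Qed.

Lemma reach_plus R M M1 M' : reach R M M1 -> plus R M1 M' -> plus R M M'.
Proof. by move=> h [A [B [h1 h2 h3]]]; exists A, B; split=> //; apply: rt_trans h h1. Qed.

Lemma lstep_red0 R M M' : lterm R M -> red0 R M M' -> lterm R M' ->
  (forall z, inb z (fv M') ==> inb z (fv M)) ->
  (R rw -> forall z, inb z (fv M) ==> inb z (fv M')) ->
  lstep R M M' /\ red R M M'.
Proof. by move=> l r l' s s'; split; [split=> //; left|]; apply: cp_base. Qed.

Lemma plus_lstep R M M' : lstep R M M' /\ red R M M' -> plus R M M'.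
Proof. by move=> h; exists M, M'; split=> //; apply: rt_refl. Qed.

(* A bound on the number of steps that expose an abstraction. *)
Fixpoint wraps (M : pterm) : nat :=
  match M with
  | Con _ _ _ g | Wk _ g => (wraps g).+1
  | _ => 0
  end.

Lemma wraps_ren r M : wraps (ren r M) = wraps M.
Proof. by elim: M => //= [x x1 x2 M ->|x M ->]. Qed.

Lemma wraps_alpha M M' : alpha M M' -> wraps M = wraps M'.
Proof.
elim=> {M M'} // [M M'|M M1 M' _ -> _ ->] //.
elim=> {M M'} //= [M M' h|x x1 x2 f g _ ->|x f g _ ->] //.
by case: h => //= *; rewrite /swap wraps_ren.
Qed.

(** A variable has a single free variable, so a substituted contraction stays a single one and a
    substituted weakening leaves at most one. *)
Lemma wraps_subst M N x P v : subst M N x P -> N = Var v -> wraps P <= wraps M.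
Proof.
move=> h; elim: h v => {M N x P} //=.
- by move=> x N v ->.
- by move=> x y M N P yx _ IH v e; rewrite mwk1; case: ifP => _ /=; have := IH _ e; lia.
- move=> x M N v -> /=; rewrite mwk1; case: ifP => _ //=; lia.
- move=> x x1 x2 M N r1 r2 P1 P2 _ _ _ _ _ _ IH1 _ IH2 v e; subst N.
  by rewrite /= enum_of_fset1 /= ltnS (leq_trans (IH2 _ erefl)) // (IH1 _ erefl).
Qed.

(** The erasure is unchanged because [x2] already has the value of [x] below the contraction and
    [x1] is not free in [M]. *)
Lemma gammaomega2 R x x1 x2 M : lterm R (Con x x1 x2 (Wk x1 M)) ->
  exists P, [/\ reach R (Con x x1 x2 (Wk x1 M)) P,
    forall rho, erase rho P = erase rho (Con x x1 x2 (Wk x1 M))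
    & wraps P <= wraps M].
Proof.
move=> l; have [c lW [ne xW hW]] := lterm_con l; have [w lM x1M] := lterm_wk lW.
have [M0 [sM dM bM]] := freshen lM [fset x; x1; x2]; have [aM lM0 fM eM] := sM.
(* [x2] may coincide with [x], which the convention for the substitution excludes; a fresh [y] takes
   its place. *)
have [y hy] := fresh_name ([fset x; x1; x2] `|` names M0).
have s1 := same_con (same_wk sM lW) l; have [_ l1 _ _] := s1.
have yM0 : y \notin names M0 by move: hy; rewrite !inbE inb_fsetU negb_or => /andP[].
have [yx yx1 yx2] : [/\ y != x, y != x1 & y != x2].
  by move: hy; setnorm; rewrite !negb_or -!andbA => /and4P[-> -> -> _].
pose M1 := swap x2 y M0.
have eW : swap x2 y (Wk x1 M0) = Wk x1 M1.
  by rewrite /swap /= (negPf ne) eq_sym (negPf yx1).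
have s2 : same R (Con x x1 x2 (Wk x1 M0)) (Con x x1 y (Wk x1 M1)).
  rewrite -eW; apply: same_con_swap2 => //.
  by move: yM0 yx1; rewrite !inbE /= inb_fset1U => /negPf-> /negPf->.
have fM1 z : inb z (fv M1) = (z == y) && inb x2 (fv M0) || inb z (fv M0) && (z != x2).
  exact: fv_swap.
have bM1 z : inb z (bn M1) = (z == y) && inb x2 (bn M0) || inb z (bn M0) && (z != x2).
  exact: bn_swap.
have yM0' : ~~ inb y (fv M0) && ~~ inb y (bn M0).
  by move: yM0; rewrite inbE namesE negb_or.
have xM1 : ~~ inb x (fv M1).
  rewrite fM1 fM eq_sym (negPf yx) /=; move: xW; setnorm.
  by case: (x =P x1) => [->|_]; move: x1M; to_inb; case: (_ == x2); boolcases.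
have bM0 z : inb z (bn M0) -> [&& z != x, z != x1 & z != x2].
  move=> zb; move: (inb_disj z dM); rewrite zb; setnorm.
  by rewrite !negb_or -andbA.
have x2b : inb x2 (bn M0) = false by apply/negP => /bM0; rewrite eqxx !andbF.
have lM1 : lterm R M1 by apply: lterm_ren => //; apply: swap_inj.
have [||||||P sP] := @subst_exists R M1 (Var x) y lM1 (lt_var R x).
- by move=> _; apply: fset_disjI => z zM; rewrite fv_var; apply: contraNneq xM1 => <-.
- by rewrite /M1 /swap barendregt_ren //; apply: swap_inj.
- by rewrite bM1 x2b andbF /=; case/andP: yM0' => _ /negPf->.
- by rewrite /= inb_fset1.
- apply: fset_disjI => z; rewrite bM1 x2b andbF /= inb_fset1 => /andP[/bM0].
  by case/and3P.
- by apply: fset_disjI => z; rewrite bn_var.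
have dx : [disjoint fv M1 & fv (Var x)].
  by apply: fset_disjI => z zM; rewrite fv_var; apply: contraNneq xM1 => <-.
have x2M : inb x2 (fv M).
  by move: (hW w); setnorm; rewrite (eq_sym x2) (negPf ne) => /andP[].
have yM1 : inb y (fv M1) by rewrite fM1 eqxx fM x2M.
have [lP fP eP] := subst_spec sP lM1 (lt_var R x) (fun _ => dx).
have x1M1 : ~~ inb x1 (fv M1).
  by rewrite fM1 eq_sym (negPf yx1) /= fM; move: x1M; to_inb => /negPf->.
have [_ l2 _ _] := s2.
exists P; split.
- apply: rt_trans (same_reach s1 l) _; apply: rt_trans (same_reach s2 l1) _.
  apply: rt_step; apply: (proj1 (lstep_red0 l2 _ lP _ _)).
  + by apply: r_gammaomega2.
  + move=> z; move: (fP z) x1M1; rewrite yM1 fv_con fv_var fv_wk /idle; to_inb.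
    by rewrite fv_wk eqxx /=; eqcases; boolcases.
  + move=> _ z; move: (fP z) x1M1; rewrite yM1 fv_con fv_var fv_wk /idle; to_inb.
    by rewrite fv_wk eqxx /=; eqcases; boolcases.
- move=> rho; rewrite eP; have [_ _ _ e1] := s1; have [_ _ _ e2] := s2.
  rewrite -e1 -e2 /=; apply: eq_erase => z zM; rewrite /upd.
  case: (z == y) => //; case: (z =P x1) => // e.
  by move: x1M1; rewrite -e /inb zM.
- apply: leq_trans (wraps_subst sP erefl) _.
  by rewrite /M1 /swap wraps_ren (wraps_alpha aM).
Qed.

(** Variables then erase to variables, so every redex of the erasure comes from an application in
    the term and not from the environment. *)
Definition is_renaming (rho : nat -> tm) : Prop := forall x, exists k, rho x = tvar k.

Lemma is_renaming_upd rho x y rho' : is_renaming rho -> is_renaming rho' ->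
  is_renaming (upd rho' x (rho y)).
Proof. by move=> h h' z; rewrite /upd; case: eqP. Qed.

Lemma is_renaming_up rho x : is_renaming rho -> is_renaming (upd (shift \o rho) x (tvar 0)).
Proof.
move=> h z; rewrite /upd; case: eqP => _; first by exists 0.
by have [k /= ->] := h z; exists k.+1.
Qed.

Definition erases_lam (M : pterm) : Prop :=
  exists rho Q, is_renaming rho /\ erase rho M = tlam Q.

(** Only a contraction needs work. It enters an exposed abstraction by gamma_1 and passes an exposed
    weakening by gamma-omega_1, unless the weakened variable is one of its own; then gamma-omega_2
    removes both and the search resumes with fewer wraps. An outermost weakening is left for
    omega_2. *)
Lemma expose R M : lterm R M -> erases_lam M ->
  exists M', [/\ reach R M M', forall rho, erase rho M' = erase rho M
    & match M' with
      | Lam _ _ => True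
      | Wk _ g => wraps g < wraps M
      | _ => False
      end].
Proof.
have [n] := ubnP (wraps M); elim: n M => // n IH M wn lM.
case: M wn lM => [x|x g|g h|x x1 x2 g|x g] wn lM [rho [Q [iv e]]].
- by have [k h] := iv x; rewrite /= h in e.
- by exists (Lam x g); split=> //; apply: rt_refl.
- by [].
- have [c lg [ne xg hg]] := lterm_con lM.
  have eg : erases_lam g.
    exists (upd (upd rho x1 (rho x)) x2 (rho x)), Q; split=> //.
    by apply: is_renaming_upd => //; apply: is_renaming_upd.
  have [g' [rg e' sg]] := IH g wn lg eg.
  have r1 := reach_ctx (ctx_con R x x1 x2) rg lM.
  have l1 := reach_lterm r1 lM.
  have ee rho' : erase rho' (Con x x1 x2 g') = erase rho' (Con x x1 x2 g).
    by rewrite /= e'.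
  have [_ lg' [_ xg' hg']] := lterm_con l1.
  case: g' rg e' sg r1 l1 ee lg' xg' hg' => // [y b|y b] rg e' sg r1 l1 ee lg' xg' hg'.
  + have [y' hy'] := fresh_name ([fset x; x1; x2] `|` names b).
    have [y'b y'x] : y' \notin names b /\ y' \notin [:: x; x1; x2].
      by move: hy'; rewrite !inE !negb_or -!andbA => /and4P[-> -> -> ->].
    have s := same_con (same_lam_swap lg' y'b) l1.
    set b' := swap y y' b in s; have [_ l2 _ es] := s.
    have [_ lL [_ xL hL]] := lterm_con l2; have [lb' yb'] := lterm_lam lL.
    exists (Lam y' (Con x x1 x2 b')); split=> //.
      apply: rt_trans r1 _; apply: rt_trans (same_reach s l1) _.
      apply: rt_step; apply: (proj1 (lstep_red0 l2 _ _ _ _)).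
      * by apply: r_gamma1.
      * move: y'x; rewrite !inE !negb_or => /and3P[yx yx1 yx2].
        constructor.
          constructor => //; first by move: xL; setnorm; rewrite (eq_sym x y') yx.
          by move=> /hL; setnorm; boolcases.
        by move=> /yb'; rewrite inbE => h; rewrite inbE fv_con h yx1 yx2 orbT.
      * move: y'x; rewrite !inE !negb_or => /and3P[yx yx1 yx2] z.
        move: yx yx1 yx2; setnorm; eqcases; boolcases.
      * move: y'x; rewrite !inE !negb_or => /and3P[yx yx1 yx2] w z.
        move: yx yx1 yx2; setnorm; eqcases; boolcases.
    move=> rho'; rewrite -ee -es /=; congr tlam; apply: eq_erase => z _.
    move: y'x; rewrite !inE !negb_or => /and3P[yx yx1 yx2].
    rewrite /upd /= (eq_sym x y') (negPf yx).
    case: (z =P y') => [->|_]; last by case: (_ == x2) => //; case: (_ == x1).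
    by rewrite (negPf yx1) (negPf yx2).
  + have [w lb yb] := lterm_wk lg'.
    (* One statement serves both contracted names; epsilon_2 brings the weakened one to the first
       place. *)
    have gam z1 z2 : y = z1 -> lterm R (Con x z1 z2 (Wk y b)) ->
        (forall rho', erase rho' (Con x z1 z2 (Wk y b)) =
                      erase rho' (Con x x1 x2 (Wk y b))) ->
        reach R (Con x x1 x2 (Wk y b)) (Con x z1 z2 (Wk y b)) ->
        exists M', [/\ reach R (Con x x1 x2 g) M',
          forall rho', erase rho' M' = erase rho' (Con x x1 x2 g)
          & match M' with
            | Lam _ _ => True
            | Wk _ k => wraps k < wraps (Con x x1 x2 g)
            | _ => False
            end].
      move=> yz lz ez rz; subst z1.
      have [P [rP eP wP]] := gammaomega2 lz.
      have lP := reach_lterm rP lz.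
      have wP' : wraps P < wraps (Con x x1 x2 g) by rewrite /= ltnS ltnW //
        (leq_ltn_trans wP).
      have eP' rho' : erase rho' P = erase rho' (Con x x1 x2 g) by rewrite eP ez ee.
      have [||M' [rM eM sM]] := IH P _ lP.
      * exact: leq_trans wP' _.
      * by exists rho, Q; split=> //; rewrite eP'.
      exists M'; split.
      * apply: rt_trans r1 _; apply: rt_trans rz _; exact: rt_trans rP rM.
      * by move=> rho'; rewrite eM eP'.
      * by case: M' sM {rM eM} => // ? ?; move/ltn_trans; apply.
    case: (y =P x1) => [yx1|/eqP yx1]; first by apply: (gam x1 x2) => //; apply: rt_refl.
    case: (y =P x2) => [yx2|/eqP yx2].
      have l2 : lterm R (Con x x2 x1 (Wk y b)).
        constructor => //; first by rewrite eq_sym.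
          by move: xg'; setnorm; rewrite orbC.
        by move=> /hg'; rewrite andbC.
      apply: (gam x2 x1) => //.
        move=> rho' /=; apply: eq_erase => z _; rewrite /upd.
        by case: (z == x1); case: (z == x2).
      apply: rt_step; split=> //.
      * by move=> z; rewrite !fv_con /idle; to_inb; case: (z == x); case: (z == x1);
        case: (z == x2); boolcases.
      * by move=> _ z; rewrite !fv_con /idle; to_inb; case: (z == x); case: (z == x1);
        case: (z == x2); boolcases.
      * by right; apply: rst_step; apply: cp_base; right; constructor.
    exists (Wk y (Con x x1 x2 b)); split.
    * apply: rt_trans r1 _; apply: rt_step; apply: (proj1 (lstep_red0 l1 _ _ _ _)).
      - by apply: r_gammaomega1.
      - constructor => //.
          constructor => //; first by move: xg'; setnorm; case: (x == y); boolcases.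
          by move=> /hg'; setnorm; rewrite eq_sym (negPf yx1) eq_sym (negPf yx2).
        by move: xg' yb yx1 yx2; setnorm; eqcases; boolcases.
      - by move=> z; move: yx1 yx2; setnorm; eqcases; boolcases.
      - by move=> _ z; move: yx1 yx2; setnorm; eqcases; boolcases.
    * by move=> rho'; rewrite -ee.
    * by rewrite /= !ltnS.
- by exists (Wk x g); split=> //; apply: rt_refl.
Qed.

Lemma erase_beta rho x M n :
  tsub (scons n tvar) (erase (upd (shift \o rho) x (tvar 0)) M) =
  erase (upd rho x n) M.
Proof.
rewrite tsub_erase; apply: eq_erase => z _; rewrite /upd /=.
by case: eqP => //= _; rewrite tsub_scons_shift.
Qed.

(** Before beta can fire, [M] and [N] are replaced by representatives whose binders cause no
    capture, and [x] by a fresh name. *)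
Lemma beta_lam R x M N : lterm R (App (Lam x M) N) ->
  exists P, plus R (App (Lam x M) N) P /\
    forall rho, erase rho P = erase (upd rho x (erase rho N)) M.
Proof.
move=> l; have [lL lN d] := lterm_app l; have [lM xM] := lterm_lam lL.
have [N0 [sN dN bN]] := freshen lN (fv N); have [_ lN0 fN eN] := sN.
have [M0 [sM dM bM]] := freshen lM (x |` (fv M `|` names N0)); have [_ lM0 fM eM] := sM.
have [y hy] := fresh_name (names M0 `|` names N0).
have [yM yN] : ~~ inb y (names M0) /\ ~~ inb y (names N0).
  by move: hy; rewrite inbE inb_fsetU negb_or => /andP[].
have s1 := same_app (same_lam sM lL) sN l; have [_ l1 _ e1] := s1.
have [lL0 _ _] := lterm_app l1.
have s2 := same_app (same_lam_swap lL0 yM) (same_refl lN0) l1.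
set M1 := swap x y M0 in s2; have [_ l2 _ e2] := s2.
have [lL1 _ d1] := lterm_app l2; have [lM1 yM1] := lterm_lam lL1.
have bM1 z : inb z (bn M1) = (z == y) && inb x (bn M0) || inb z (bn M0) && (z != x).
  exact: bn_swap.
have xb : inb x (bn M0) = false.
  by apply/negP => xb; move: (inb_disj x dM); rewrite xb inb_fset1U eqxx.
have yb : ~~ inb y (bn M1).
  by rewrite bM1 xb andbF /=; move: yM; setnorm; boolcases.
have dM1 : R rc -> [disjoint fv M1 & fv N0].
  move=> c; apply: fset_disjI => z; move: (inb_disj z (d1 c)) yN; setnorm.
  by eqcases; boolcases.
have [|||||P sP] := @subst_exists R M1 N0 y lM1 lN0 dM1.
- by rewrite /M1 /swap barendregt_ren //; apply: swap_inj.
- exact: yb.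
- exact: yN.
- apply: fset_disjI => z; rewrite bM1 xb andbF /=.
  by move: (inb_disj z dM); rewrite inb_fset1U inb_fsetU; boolcases.
- by rewrite fN.
have [lP fP eP] := subst_spec sP lM1 lN0 dM1.
exists P; split.
  apply: reach_plus (same_reach s1 l) _; apply: reach_plus (same_reach s2 l1) _.
  apply: plus_lstep; apply: lstep_red0 => //.
  - by apply: r_beta sP.
  - by move=> z; move: (fP z) (fP y); rewrite !inb_fv; eqcases; boolcases.
  - by move=> w z; move: (fP z) (yM1 w); rewrite inbE !inb_fv; eqcases; boolcases.
move=> rho; rewrite eP eN.
have e : erase rho (App (Lam y M1) N0) = erase rho (App (Lam x M) N) by rewrite e2 e1.
(* Equal abstractions have equal bodies; instantiating these with the erasure of [N] gives an
   equality between updated environments. *)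
case: e => e _; have := congr1 (tsub (scons (erase rho N) tvar)) e.
by rewrite !erase_beta.
Qed.

(** A weakening exposed above the abstraction leaves the application by omega_2, or vanishes if its
    variable is free in [N]; its body has fewer wraps, so the induction goes on below it. *)
Lemma beta_sim R M N rho Q : lterm R (App M N) -> is_renaming rho ->
  erase rho M = tlam Q ->
  exists P, plus R (App M N) P /\ erase rho P = tsub (scons (erase rho N) tvar) Q.
Proof.
have [n] := ubnP (wraps M); elim: n M => // n IH M wn l iv e.
have [lM lN d] := lterm_app l.
have [|M' [rM eM sM]] := expose lM; first by exists rho, Q.
have r1 := reach_ctx (ctx_appl R N) rM l; have l1 := reach_lterm r1 l.
case: M' rM eM sM r1 l1 => // [x b|y b] rM eM sM r1 l1.
  have [P [hP eP]] := beta_lam l1; exists P; split; first exact: reach_plus r1 hP.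
  by rewrite eP -erase_beta; congr tsub; move: (eM rho); rewrite e => -[].
have [lW _ d1] := lterm_app l1; have [w lb yb] := lterm_wk lW.
have d2 : R rc -> [disjoint fv b & fv N].
  by move=> c; apply: fset_disjI => z; move: (inb_disj z (d1 c)); rewrite fv_wk; boolcases.
have l2 : lterm R (App b N) by constructor.
have eb : erase rho b = tlam Q by rewrite -e -eM.
have [P [hP eP]] := IH b (leq_trans sM wn) l2 iv eb.
have rA := @r_omega2 R y b N w; rewrite mwk1 in rA.
have [yN|yN] := boolP (inb y (fv N)).
  exists P; split=> //; apply: reach_plus r1 _; apply: reach_plus hP.
  apply: rt_step; apply: (proj1 (lstep_red0 l1 _ l2 _ _)).
  - by rewrite yN in rA.
  - by move=> z; rewrite !inb_fv; boolcases.
  - by move=> _ z; move: yN; rewrite !inb_fv; eqcases; boolcases.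
rewrite (negPf yN) in rA.
have l3 : lterm R (Wk y (App b N)).
  by constructor => //; move: yb yN; setnorm; boolcases.
exists (Wk y P); split=> //; apply: reach_plus r1 _.
apply: reach_plus (plus_ctx (ctx_wk R y) hP l3).
apply: rt_step; apply: (proj1 (lstep_red0 l1 rA l3 _ _)).
- by move=> z; rewrite !inb_fv; case: (z == y); boolcases.
- by move=> _ z; rewrite !inb_fv; case: (z == y); boolcases.
Qed.

Lemma simulation R M rho Q : lterm R M -> is_renaming rho -> beta (erase rho M) Q ->
  exists M', plus R M M' /\ erase rho M' = Q.
Proof.
elim: M rho Q => [x|x M IH|M IHM N IHN|x x1 x2 M IH|x M IH] rho Q l iv h.
- by have [k e] := iv x; rewrite /= e in h; inversion h.
- have [lM _] := lterm_lam l; inversion h; subst.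
  have [M1 [h1 e1]] := IH _ _ lM (is_renaming_up x iv) H0.
  exists (Lam x M1); split; last by rewrite /= e1.
  exact: plus_ctx (ctx_lam R x) h1 l.
- have [lM lN _] := lterm_app l; rewrite /= in h; inversion h; subst.
  + by apply: beta_sim.
  + have [M1 [h1 e1]] := IHM _ _ lM iv H2.
    exists (App M1 N); split; last by rewrite /= e1.
    exact: plus_ctx (ctx_appl R N) h1 l.
  + have [N1 [h1 e1]] := IHN _ _ lN iv H2.
    exists (App M N1); split; last by rewrite /= e1.
    exact: plus_ctx (ctx_appr R M) h1 l.
- have [_ lM _] := lterm_con l.
  have [|M1 [h1 e1]] := IH _ _ lM _ h; first by apply: is_renaming_upd => //;
    apply: is_renaming_upd.
  by exists (Con x x1 x2 M1); split=> //; apply: plus_ctx (ctx_con R x x1 x2) h1 l.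
- have [_ lM _] := lterm_wk l; have [M1 [h1 e1]] := IH _ _ lM iv h.
  by exists (Wk x M1); split=> //; apply: plus_ctx (ctx_wk R x) h1 l.
Qed.

(** * Strong normalisation of the erasure *)

Definition eqv_red (R : pred resource) (M B : pterm) : Prop :=
  exists A, [/\ lterm R M, eqv R M A, lterm R A, red R A B & lterm R B].

Lemma sn_acc R M : lterm R M -> strongly_normalising R M ->
  Acc (fun B A => eqv_red R A B) M.
Proof.
move=> lM sn; apply: NNPP => nacc; apply: sn.
pose T := {A : pterm | ~ Acc (fun B A => eqv_red R A B) A}.
have next (A : T) : {B : T | eqv_red R (proj1_sig A) (proj1_sig B)}.
  apply: constructive_indefinite_description; case: A => A nA /=.
  apply: NNPP => h; apply: nA; constructor => B AB; apply: NNPP => nB.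
  by apply: h; exists (exist _ B nB).
pose f n : T := iter n (fun A => proj1_sig (next A)) (exist _ M nacc).
have mid n : {A | [/\ lterm R (proj1_sig (f n)), eqv R (proj1_sig (f n)) A, lterm R A,
    red R A (proj1_sig (f n.+1)) & lterm R (proj1_sig (f n.+1))]}.
  by apply: constructive_indefinite_description; apply: (proj2_sig (next (f n))).
(* Even positions hold the [f n], odd ones the equivalent term that reduces to [f n.+1]: equivalence
   and reduction alternate. *)
exists (fun k => if odd k then proj1_sig (mid k./2) else proj1_sig (f k./2)).
split=> //.
- move=> n; case: (odd n); first by case: (proj2_sig (mid n./2)).
  by case: (proj2_sig (mid n./2)).
- move=> n; rewrite /= uphalf_half; case: (odd n) => /=.
    by left; rewrite ?add1n; case: (proj2_sig (mid n./2)).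
  by right; rewrite ?add0n; case: (proj2_sig (mid n./2)).
- move=> n; exists n.*2.+1; first by rewrite -addnn; lia.
  rewrite /= odd_double /= uphalf_double doubleK.
  by case: (proj2_sig (mid n)).
Qed.

(** The path is cut at its first reduction step; the equivalence steps before it merge into one. *)
Lemma reach_split R M A : reach R M A -> lterm R M ->
  eqv R M A \/ exists2 B, eqv_red R M B & reach R B A.
Proof.
move=> /clos_rt_rt1n_iff; elim=> {M A} [M|M M1 A h1 h2 IH] l; first by left;
  apply: rst_refl.
have [_ l1 _ _ h] := h1.
case: h => h.
  by right; exists M1; [exists M; split=> //; apply: rst_refl | apply/clos_rt_rt1n_iff].
case: (IH l1) => [h'|[B [A' [_ h3 h4 h5 h6]] hB]].
  by left; apply: rst_trans h h'.
by right; exists B => //; exists A'; split=> //; apply: rst_trans h h3.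
Qed.

Lemma plus_split R M M' : plus R M M' -> lterm R M ->
  exists2 B, eqv_red R M B & reach R B M'.
Proof.
move=> [A [B [h1 [h2 h3] h4]]] l; have lA := reach_lterm h1 l.
have [_ lB _ _ _] := h2.
case: (reach_split h1 l) => [h|[B' hB' h]]; first by exists B => //; exists A.
exists B' => //; apply: rt_trans h _; apply: rt_trans h4; exact: rt_step.
Qed.

(** All [M'] reachable from [M] are covered, because a simulating path may continue after its first
    reduction: the induction hypothesis is used at the result of that reduction, and the rest of the
    path is kept as reachability. *)
Lemma acc_erase R M : Acc (fun B A => eqv_red R A B) M -> lterm R M ->
  forall M' rho, reach R M M' -> is_renaming rho ->
    Acc (fun B A => beta A B) (erase rho M').
Proof.
elim=> {}M _ IH l M' rho h iv; constructor => Q hQ.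
have l' := reach_lterm h l.
have [M1 [h1 <-]] := simulation l' iv hQ.
have [B hB hB'] := plus_split (reach_plus h h1) l.
by have [A [_ _ _ _ lB]] := hB; apply: IH hB lB _ _ hB' iv.
Qed.

(** * From typings of the erasure to typings of the term *)

Local Open Scope fmap_scope.

Fixpoint leaves (a : ty) : seq sty :=
  match a with
  | Str t => [:: t]
  | Cap b c => leaves b ++ leaves c
  end.

(** The right-nested form that [bigcap] gives to a family enumerated by a nonempty list. *)
Fixpoint capseq (t : sty) (l : seq sty) : ty :=
  if l is u :: l' then Cap (Str t) (capseq u l') else Str t.

Lemma capseq_cat t l u l' :
  ty_eq (capseq t (l ++ u :: l')) (Cap (capseq t l) (capseq u l')).
Proof.
elim: l t => [|v l IH] t /=; first exact: te_refl.
apply: te_trans (te_assoc _ _ _); apply: te_cap (IH v); exact: te_refl.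
Qed.

Lemma leaves_capseq a : exists t l, leaves a = t :: l /\ ty_eq (capseq t l) a.
Proof.
elim: a => [t|a [t [l [ea ha]]] b [u [l' [eb hb]]]] /=.
  by exists t, [::]; split => //; apply: te_refl.
exists t, (l ++ u :: l'); split; first by rewrite ea eb.
by apply: te_trans (capseq_cat _ _ _ _) _; apply: te_cap.
Qed.

Lemma tin_leaves t a : tin t a <-> List.In t (leaves a).
Proof.
elim: a => [s|a IHa b IHb] /=; first by split=> [->|[->|//]]; auto.
by rewrite List.in_app_iff IHa IHb.
Qed.

Lemma bigcap_nth t l :
  bigcap (fun i : 'I_(size l).+1 => nth t (t :: l) i) = capseq t l.
Proof.
(* The default of [nth] is detached from the head [t], which changes in the induction. *)
suff h d : fold1 Cap (fun i : 'I_(size l).+1 => Str (nth d (t :: l) i)) =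
  capseq t l by apply: h.
elim: l t => [|u l IH] t //=; congr Cap; exact: IH.
Qed.

(** The bridge from leaves to the indexed families of the typing rules. *)
Lemma ty_eq_bigcap a : exists n (s : 'I_n.+1 -> sty),
  [/\ ty_eq (bigcap s) a, forall i, tin (s i) a &
      forall t, tin t a -> exists i, s i = t].
Proof.
have [t [l [ea ha]]] := leaves_capseq a.
exists (size l), (fun i => nth t (t :: l) i); split.
- by rewrite bigcap_nth.
- move=> i; apply/tin_leaves; rewrite ea.
  elim: (t :: l) (i : nat) (ltn_ord i : i < size (t :: l)) => // u l' IH [|k] /=; auto.
- move=> u /tin_leaves; rewrite ea => hu.
  suff [k hk e] : exists2 k, k < (size l).+1 & nth t (t :: l) k = u.
    by exists (Ordinal hk).
  change (exists2 k, k < size (t :: l) & nth t (t :: l) k = u).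
  elim: (t :: l) hu => //= v l' IH [->|/IH[k hk e]]; first by exists 0.
  by exists k.+1.
Qed.

Definition restr (S : {fset nat}) (T : nat -> ty) : basis :=
  [fmap x : S => T (val x)].

Lemma fnd_restr S T (x : nat) :
  (restr S T).[? x] = if inb x S then Some (T x) else None.
Proof.
rewrite /inb; case: ifP => xS; first by rewrite /restr (in_fnd (xS : x \in domf (restr
  S T))) ffunE.
by apply: not_fnd; rewrite /= xS.
Qed.

Lemma fnd_bjoin (G D : basis) (x : nat) :
  (bjoin G D).[? x] = match G.[? x], D.[? x] with
                      | Some a, Some b => Some (Cap a b)
                      | Some a, None => Some a
                      | None, o => o
                      end.
Proof.
have e : (G + D).[? x] = if D.[? x] is Some b then Some b else G.[? x].
  rewrite fnd_cat; case: (boolP (x \in domf D)) => xD; last by rewrite (not_fnd xD).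
  by rewrite in_fnd.
case: (boolP (x \in domf (bjoin G D))) => h.
  have h' : (G + D).[? x] = Some ((G + D) (FSetSub h)) by rewrite -in_fnd.
  rewrite in_fnd ffunE /=; move: h'; rewrite e.
  by case: (G.[? x]) => [a|]; case: (D.[? x]) => [b|] // [->].
have : (G + D).[? x] = None by apply: not_fnd.
by rewrite e (not_fnd h); case: (D.[? x]) => // ->.
Qed.

Lemma basis_eq_refl G : basis_eq G G.
Proof. by move=> x; case: (G.[? x]) => // a; apply: te_refl. Qed.

Lemma basis_eq_restr S T (D : basis) :
  (forall x : nat, match D.[? x] with
            | Some a => inb x S /\ ty_eq (T x) a
            | None => ~~ inb x S
            end) ->
  basis_eq D (restr S T).
Proof.
move=> h x; move: (h x); rewrite fnd_restr; case: (D.[? x]) => [a [-> ?]|/negPf-> //].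
exact: te_sym.
Qed.

(** All derivations for an argument will use the same basis; idempotence absorbs its repetitions. *)
Lemma fnd_fold1 n S T (x : nat) :
  match (fold1 bjoin (fun _ : 'I_n.+1 => restr S T)).[? x] with
  | Some a => inb x S /\ ty_eq (T x) a
  | None => ~~ inb x S
  end.
Proof.
elim: n => [|n] /=; first by rewrite fnd_restr; case: ifP => // _; split=> //;
  apply: te_refl.
rewrite fnd_bjoin fnd_restr; case: (fnd _ _) => [a [-> h]|/negPf-> //]; split=> //.
by apply: te_trans (te_sym (te_idem _)) (te_cap (te_refl _) h).
Qed.

Lemma dom_fold1 n S T :
  domf (fold1 bjoin (fun _ : 'I_n.+1 => restr S T)) = S.
Proof.
apply: fset_eqI => z; have := fnd_fold1 n S T z.
by case: fndP => [zd [-> _]|zd /negPf ->]; [exact: zd | exact: negPf].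
Qed.

(* The names of the idle contractions: [ty_cont] puts them in the basis. *)
Fixpoint idles (f : pterm) : {fset nat} :=
  match f with
  | Var _ => fset0
  | Lam _ g | Wk _ g => idles g
  | App g h => idles g `|` idles h
  | Con x x1 x2 g => (if idle x1 x2 g then [fset x] else fset0) `|` idles g
  end.

Lemma idles_con (x x1 x2 : nat) f (z : nat) :
  inb z (idles (Con x x1 x2 f)) = (z == x) && idle x1 x2 f || inb z (idles f).
Proof. by rewrite /= inb_fsetU; case: ifP; rewrite ?inb_set ?andbT ?andbF. Qed.

Lemma idles_app f g (z : nat) :
  inb z (idles (App f g)) = inb z (idles f) || inb z (idles g).
Proof. exact: inb_fsetU. Qed.

Lemma idles_bn f (z : nat) : inb z (idles f) ==> inb z (bn f).
Proof.
elim: f => [x|x f IH|f IHf g IHg|x x1 x2 f IH|x f IH] //.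
- by rewrite bn_lam; move: IH => /=; boolcases; rewrite orbT.
- by rewrite idles_app bn_app; move: IHf IHg; boolcases.
- by rewrite idles_con bn_con; move: IH; case: idle; boolcases;
  rewrite ?orbT ?andbT ?orbF; do ?case: eqP.
Qed.

Lemma typed_eq R G D M s t :
  typed R G M s -> basis_eq G D -> sty_eq s t -> typed R D M t.
Proof. by move=> h GD st; apply: ty_conv h GD _ st; apply: rst_refl. Qed.

(* [e] names the variables of the erasure; under [R rw] there is no weakening,
   so [D] hastype to be [fv f]. *)
Lemma typed_erase R G e f t (D : {fset nat}) :
  lterm R f -> barendregt f -> fv f `<=` D -> (R rw -> D = fv f) ->
  [disjoint bn f & D] -> hastype G (erase (tvar \o e) f) t ->
  typed R (restr (D `|` idles f) (G \o e)) f t.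
Proof.
move=> lf; elim: lf G e t D => {f}.
- move=> x G e t D _ xD DE _ /= h; inversion h; subst => {h}.
  have [n [s [hs _ /(_ _ H1) [i <-]]]] := ty_eq_bigcap (G (e x)).
  have xD' : inb x D by move/fsubsetP: xD; apply; rewrite inE.
  case: (boolP (R rw)) => w.
    apply: (typed_eq (ty_axew x s i w)); last exact: se_refl.
    apply: basis_eq_restr => y; rewrite fnd_set fnd_fmap0 (DE w) ?inN.
    by case: (y =P x) => [->|//]; split=> //; apply: te_sym.
  have xn : x \notin domf (restr (D `\ x) (G \o e)) by rewrite /= inbE inN eqxx.
  apply: (typed_eq (ty_axiw s i w xn)); last exact: se_refl.
  apply: basis_eq_restr => y; rewrite fnd_set fnd_restr ?inN orbF.
  by case: (y =P x) => [->|_] /=; [split=> //; apply: te_sym | case: ifP => // _;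
    split=> //; apply: te_refl].
- move=> x f lf IH xf G e t D /andP[xb bf] fD DE dis h.
  have disx := inb_disj x dis; rewrite inN eqxx /= in disx.
  inversion h; subst => {h}.
  have {}IH : typed R (restr (D `|` [fset x] `|` idles f) (upd (G \o e) x a)) f t0.
    have -> : restr (D `|` [fset x] `|` idles f) (upd (G \o e) x a) =
      restr (D `|` [fset x] `|` idles f) (scons a G \o upd (S \o e) x 0).
      apply/fmapP => y; rewrite !fnd_restr /upd /=; case: ifP => // _.
      by case: (y =P x).
    apply: IH => //.
    + by apply: fset_subI => z; move: (inb_sub z fD); eqlia.
    + move=> w; apply: fset_eqI => z; move: (xf w); rewrite (DE w); eqlia.
    + by apply: fset_disjI => z; move: xb (inb_disj z dis); eqlia.
    + by rewrite (@eq_erase _ (upd (shift \o (tvar \o e)) x (tvar 0))) // => y _;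
      rewrite /upd /=; case: eqP.
  have xn : x \notin domf (restr (D `|` idles f) (G \o e)).
    by rewrite /= inbE ?inN; have := idles_bn f x; move: xb disx; to_inb; boolcases.
  constructor => //; apply: typed_eq IH _ (se_refl _).
  move=> y; rewrite fnd_set !fnd_restr ?inN /upd.
  case: (y =P x) => [->|_] /=; first by rewrite orbT; apply: te_refl.
  by rewrite orbF; case: ifP => // _; apply: te_refl.
- move=> f g lf IHf lg IHg dfg G e t D /and3P[bfg bf bg] fD DE dis h.
  inversion h; subst => {h}.
  have [n [s [hs hsa hastype]]] := ty_eq_bigcap a.
  (* The function keeps all of [D] except the variables free only in the argument, which gets
     [fv g]. Under explicit contraction these two sets are disjoint, and under explicit weakening
     [D1] is [fv f]. *)
  pose D1 := D `\` (fv g `\` fv f).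
  have tf : typed R (restr (D1 `|` idles f) (G \o e)) f (Arr (bigcap s) t).
    apply: typed_eq (IHf _ _ _ D1 bf _ _ _ H2) (basis_eq_refl _) _.
    + by apply: fset_subI => z; move: (inb_sub z fD); rewrite /D1; setnorm; boolcases.
    + by move=> w; apply: fset_eqI => z; rewrite /D1 (DE w); setnorm; boolcases.
    + by apply: fset_disjI => z; move: (inb_disj z dis); rewrite /D1; setnorm; boolcases.
    + by apply: se_arr (te_sym hs) (se_refl _).
  have tg i : typed R (restr (fv g `|` idles g) (G \o e)) g (s i).
    apply: IHg => //; last exact: H4.
    apply: fset_disjI => z; move: (inb_disj z dis) (inb_sub z fD).
    by setnorm; boolcases.
  have dj : R rc -> [disjoint domf (restr (D1 `|` idles f) (G \o e)) &
     domf (fold1 bjoin (fun _ : 'I_n.+1 => restr (fv g `|` idles g) (G \o e)))].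
    move=> c; rewrite dom_fold1; apply: fset_disjI => z /=; rewrite /D1.
    move: (inb_disj z dis) (inb_disj z bfg) (inb_disj z (dfg c)) (inb_sub z fD).
    by move: (idles_bn f z) (idles_bn g z); setnorm; boolcases.
  have := ty_arrE tf tg (fun _ _ => erefl) dj.
  move=> h; apply: typed_eq h _ (se_refl _).
  apply: basis_eq_restr => z.
  have := fnd_fold1 n (fv g `|` idles g) (G \o e) z.
  rewrite /bjoinc; case: (boolP (R rc)) => c.
  + rewrite fnd_cat; case: fndP => [zd [zg hz]|zd zg].
      split => //; move: zg (inb_sub z fD).
      by rewrite ?inN ?idles_app; boolcases.
    rewrite fnd_restr /D1; case: ifP => h1; first split; try exact: te_refl.
      by move: h1 zg; rewrite ?inN ?idles_app; boolcases.
    by move: h1 zg; rewrite ?inN ?idles_app; boolcases.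
  + rewrite fnd_bjoin fnd_restr /D1; case: (fnd _ _) => [b [zg hb]|zg]; case: ifP => h1.
    * split; last by apply: te_trans (te_sym (te_idem _)) (te_cap (te_refl _) hb).
      by move: h1; setnorm; rewrite ?idles_app; boolcases.
    * split=> //; move: zg (inb_sub z fD).
      by setnorm; rewrite ?idles_app; boolcases.
    * split; last exact: te_refl.
      by move: h1 zg; setnorm; rewrite ?idles_app; boolcases.
    * by move: h1 zg; setnorm; rewrite ?idles_app; boolcases.
- move=> x f w lf IH xf G e t D bf fD DE dis h.
  pose D1 := D `\ x.
  have tf : typed R (restr (D1 `|` idles f) (G \o e)) f t.
    apply: IH => //.
    + by apply: fset_subI => z; move: xf (inb_sub z fD); rewrite /D1; eqlia.
    + by move=> _; apply: fset_eqI => z; move: xf; rewrite /D1 (DE w); eqlia.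
    + by apply: fset_disjI => z; move: (inb_disj z dis); rewrite /D1; eqlia.
  have xD : inb x D by rewrite (DE w) inN eqxx.
  have xn : x \notin domf (restr (D1 `|` idles f) (G \o e)).
    move: (inb_disj x dis) (idles_bn f x) xD; rewrite /= /D1; eqlia.
  apply: typed_eq (ty_weak (G (e x)) w xn tf) _ (se_refl _).
  move=> z; rewrite fnd_set !fnd_restr /D1 ?inN.
  case: (z =P x) => [->|zx] /=; first by rewrite xD; apply: te_refl.
  by case: ifP => // _; apply: te_refl.
- move=> x x1 x2 f c lf IH ne xf hw G e t D /and4P[x1b x2b xb bf] fD DE dis h.
  have disx := inb_disj x dis; have disx1 := inb_disj x1 dis; have disx2 := inb_disj x2 dis.
  rewrite bn_con eqxx /= in disx; rewrite bn_con eqxx /= in disx1.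
  rewrite bn_con eqxx orbT /= in disx2.
  pose D1 := D `\ x.
  (* Both contracted names get the type of [x], as both erase to its image; the intersection of this
     type with itself is absorbed by idempotence. *)
  pose T := upd (upd (G \o e) x1 (G (e x))) x2 (G (e x)).
  have tf : typed R (restr (D1 `|` [fset x1; x2] `|` idles f) T) f t.
    have -> : restr (D1 `|` [fset x1; x2] `|` idles f) T =
      restr (D1 `|` [fset x1; x2] `|` idles f) (G \o (upd (upd e x1 (e x)) x2 (e x))).
      apply/fmapP => y; rewrite !fnd_restr /T /upd /=; case: ifP => // _.
      by case: (y =P x2) => // _; case: (y =P x1).
    apply: IH => //.
    + apply: fset_subI => z; move: xf (inb_sub z fD); rewrite /D1.
      by eqlia.
    + move=> w; apply: fset_eqI => z; move: xf (hw w); rewrite /D1 (DE w).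
      by eqlia.
    + apply: fset_disjI => z; move: (inb_disj z dis) x1b x2b; rewrite /D1.
      by eqlia.
    + by rewrite (@eq_erase _ (upd (upd (tvar \o e) x1 (tvar (e x))) x2 (tvar (e x))))
      // => y _; rewrite /upd /=; case: (y =P x2) => // _; case: (y =P x1).
  have x1n : x1 \notin domf (restr (D1 `|` idles f) (G \o e)).
    by move: (idles_bn f x1) x1b disx1; rewrite /= /D1; setnorm; boolcases.
  have x2n : x2 \notin domf (restr (D1 `|` idles f) (G \o e)).
    by move: (idles_bn f x2) x2b disx2; rewrite /= /D1; setnorm; boolcases.
  (* An idle name counts as bound, hence lies outside [D]; it enters the basis through [idles]. *)
  have xD : inb x D = ~~ idle x1 x2 f.
    move: disx (inb_sub x fD); rewrite fv_con eqxx /=.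
    by case: idle; rewrite /= ?orbT //; boolcases.
  have xn : x \notin domf (restr (D1 `|` idles f) (G \o e)).
    move: (idles_bn f x) xb; rewrite /= /D1; to_inb; rewrite !inb_set eqxx /=.
    case: (boolP (idle _ _ _)) => i /=; first by move=> + /and3P[_ _]; boolcases.
    by move: disx; rewrite xD (negPf i); boolcases; rewrite ?orbT.
  have tf' : typed R (restr (D1 `|` idles f) (G \o e)).[x1 <- G (e x)].[x2 <- G (e x)] f t.
    apply: typed_eq tf _ (se_refl _) => y; rewrite !fnd_set !fnd_restr ?inN /T /upd.
    case: (y =P x2) => _; first by rewrite ?orbT; apply: te_refl.
    case: (y =P x1) => _; first by rewrite ?orbT; apply: te_refl.
    by rewrite /= orbF; case: ifP => // _; apply: te_refl.
  apply: typed_eq (ty_cont c ne x1n x2n xn tf') _ (se_refl _) => y.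
  rewrite fnd_set !fnd_restr.
  have -> : inb y (D `|` idles (Con x x1 x2 f)) = (y == x) || inb y (D1 `|` idles f).
    rewrite /D1 inb_fsetU idles_con !inb_set; case: (y =P x) => [->|_] //=.
    by rewrite xD orbA orNb.
  case: (y =P x) => [->|_] /=; first exact: te_idem.
  by case: ifP => // _; apply: te_refl.
Qed.

Theorem theorem4 (R : pred resource) (M : pterm) :
  lterm R M -> strongly_normalising R M ->
  exists (G : basis) (s : sty), typed R G M s.
Proof.
move=> lM sn.
have iv : is_renaming (tvar \o id) by move=> x; exists x.
have acc := acc_erase (sn_acc lM sn) lM (rt_refl _ _ M) iv.
have [G [t ht]] := sn_typeable acc.
(* The transfer of typings needs binders apart from one another and from the free variables; [M0]
   provides them and alpha-conversion leads back to [M]. *)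
have [M0 [[a l0 f0 e0] d0 b0]] := freshen lM (fv M).
exists (restr (fv M0 `|` idles M0) (G \o id)), t.
apply: ty_conv (basis_eq_refl _) _ (se_refl _); last exact: rst_sym a.
apply: typed_erase => //; first by rewrite f0.
by rewrite e0.
Qed.
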